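(* The fixed-charge transportation problem restricted to instances whose underlying graph is a tree is solvable in pseudo-polynomial time. That is, there is an algorithm which, given a tree $G=(V,E)$, integers $b_i\ge 0$ ($i\in V$) and rational cost vectors $p,q\in\mathbb{Q}^E$, computes an optimal solution of $$\min\ \sum_{(i,j)\in E}\left(p_{ij}x_{ij}+q_{ij}y_{ij}\right)$$ subject to $$\sum_{j\in V:\,(i,j)\in E}x_{ij}\le b_i\ (i\in V),\qquad 0\le x_{ij}\le a_{ij}y_{ij},\quad y_{ij}\in\{0,1\}\ ((i,j)\in E),$$ where $a_{ij}:=\min\{b_i,b_j\}$, in time polynomial in $|V|$, $\max_{i\in V} b_i$ and the encoding length of $p$ and $q$.
   Context: Graphs are undirected: $(i,j)=(j,i)$ denotes a single edge, and $x_{ij}=x_{ji}$, $y_{ij}=y_{ji}$, $a_{ij}=a_{ji}$ are indexed by edges. The variables $x_{ij}$ are real. *)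

(* Defs.v *)
From HB Require Import structures.
From mathcomp Require Import all_boot all_order all_algebra.
From mathcomp Require Import reals.
Set Implicit Arguments.
Unset Strict Implicit.
Unset Printing Implicit Defensive.
Import Order.TTheory GRing.Theory Num.Theory.
Local Open Scope ring_scope.

(* The vertex set is 'I_n, and an undirected graph on it is an adjacency
   relation. A quantity z_ij indexed by undirected edges is a function of two
   vertices with z i j = z j i on edges; its values off the edges are
   irrelevant everywhere below. *)
Record instance := Instance {
  nvert : nat;
  edge : rel 'I_nvert;
  cap : 'I_nvert -> nat;
  pcost : 'I_nvert -> 'I_nvert -> rat;
  qcost : 'I_nvert -> 'I_nvert -> rat
}.

Definition edge_symmetric (n : nat) (T : Type) (e : rel 'I_n)
    (z : 'I_n -> 'I_n -> T) : Prop :=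
  forall i j : 'I_n, e i j -> z i j = z j i.

(* Since e is symmetric, [:: u; v] is an e-cycle for every edge (u, v): graph
   cycles are the duplicate-free e-cycles with at least 3 vertices. *)
Definition is_tree (n : nat) (e : rel 'I_n) : Prop :=
  [/\ (0 < n)%N,
      symmetric e,
      irreflexive e,
      (forall i j : 'I_n, connect e i j)
    & (forall c : seq 'I_n, (2 < size c)%N -> ~ ucycle e c)].

Definition tree_instance (I : instance) : Prop :=
  [/\ is_tree (@edge I),
      edge_symmetric (@edge I) (@pcost I)
    & edge_symmetric (@edge I) (@qcost I)].

Definition edge_cap (I : instance) (i j : 'I_(nvert I)) : nat :=
  minn (cap i) (cap j).

(* The constraint y_ij \in {0,1} is the type bool. *)
Definition feasible (R : realType) (I : instance)
    (x : 'I_(nvert I) -> 'I_(nvert I) -> R)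
    (y : 'I_(nvert I) -> 'I_(nvert I) -> bool) : Prop :=
  [/\ edge_symmetric (@edge I) x,
      edge_symmetric (@edge I) y,
      (forall i, \sum_(j | edge i j) x i j <= (cap i)%:R)
    & (forall i j, edge i j -> 0 <= x i j <= (edge_cap i j)%:R * (y i j)%:R)].

(* The condition i < j makes every undirected edge count once. *)
Definition objective (R : realType) (I : instance)
    (x : 'I_(nvert I) -> 'I_(nvert I) -> R)
    (y : 'I_(nvert I) -> 'I_(nvert I) -> bool) : R :=
  \sum_(i < nvert I) \sum_(j < nvert I | (i < j)%N && edge i j)
    (ratr (pcost i j) * x i j + ratr (qcost i j) * (y i j)%:R).

Definition optimal (R : realType) (I : instance)
    (x : 'I_(nvert I) -> 'I_(nvert I) -> R)
    (y : 'I_(nvert I) -> 'I_(nvert I) -> bool) : Prop :=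
  feasible x y /\
  (forall (x' : 'I_(nvert I) -> 'I_(nvert I) -> R)
          (y' : 'I_(nvert I) -> 'I_(nvert I) -> bool),
     feasible x' y' -> objective x y <= objective x' y').

(* A sign bit and ceil(log2(|z| + 1)) binary digits. *)
Definition bitsize (z : int) : nat := (up_log 2 (absz z).+1).+1.

Definition rat_length (r : rat) : nat := (bitsize (numq r) + bitsize (denq r))%N.

Definition cost_length (I : instance) : nat :=
  (\sum_(i < nvert I) \sum_(j < nvert I | (i < j)%N && edge i j)
     (rat_length (pcost i j) + rat_length (qcost i j)))%N.

Definition max_cap (I : instance) : nat := (\max_(i < nvert I) cap i)%N.

(* A random access machine with structured control flow and the logarithmic
   cost criterion: every access and every operation is charged the binary
   lengths of the addresses and integers involved, so that running times agree
   with Turing machine times up to a polynomial. The memory consists of integer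
   arrays; a program names arrays by constants, so that it uses finitely many
   of them, while positions inside an array are computed at run time. *)
Definition state := nat -> int -> int.

Definition update (s : state) (a : nat) (k v : int) : state :=
  fun a' k' => if (a' == a) && (k' == k) then v else s a' k'.

Inductive binop := Add | Sub | Mul | Leq.

Inductive expr :=
| Cst of int
| Get of nat & expr
| Bin of binop & expr & expr.

Definition eval_op (o : binop) (u v : int) : int :=
  match o with
  | Add => u + v
  | Sub => u - v
  | Mul => u * v
  | Leq => ((u <= v)%R : nat)%:Z
  end.

Fixpoint eval (s : state) (e : expr) : int :=
  match e with
  | Cst z => z
  | Get a e1 => s a (eval s e1)
  | Bin o e1 e2 => eval_op o (eval s e1) (eval s e2)
  end.

Fixpoint eval_cost (s : state) (e : expr) : nat :=
  match e with
  | Cst z => bitsize z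
  | Get a e1 => (eval_cost s e1 + bitsize (eval s e1) + bitsize (eval s e))%N
  | Bin o e1 e2 =>
      (eval_cost s e1 + eval_cost s e2
         + bitsize (eval s e1) + bitsize (eval s e2))%N
  end.

(* [Set_ a e1 e2] writes e2 at position e1 of array a; a guard holds when its
   value is nonzero. *)
Inductive cmd :=
| Skip
| Set_ of nat & expr & expr
| Seq of cmd & cmd
| If of expr & cmd & cmd
| While of expr & cmd.

(* [exec c s t s']: from s, the program c halts in s' after time t. *)
Inductive exec : cmd -> state -> nat -> state -> Prop :=
| exec_skip s :
    exec Skip s 1 s
| exec_set a e1 e2 s :
    exec (Set_ a e1 e2) s
      (eval_cost s e1 + eval_cost s e2
         + bitsize (eval s e1) + bitsize (eval s e2))%N
      (update s a (eval s e1) (eval s e2))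
| exec_seq c1 c2 s t1 s1 t2 s2 :
    exec c1 s t1 s1 -> exec c2 s1 t2 s2 ->
    exec (Seq c1 c2) s (t1 + t2).+1 s2
| exec_if_true e c1 c2 s t s' :
    eval s e != 0 -> exec c1 s t s' ->
    exec (If e c1 c2) s (eval_cost s e + t).+1 s'
| exec_if_false e c1 c2 s t s' :
    eval s e = 0 -> exec c2 s t s' ->
    exec (If e c1 c2) s (eval_cost s e + t).+1 s'
| exec_while_true e c s t1 s1 t2 s2 :
    eval s e != 0 -> exec c s t1 s1 -> exec (While e c) s1 t2 s2 ->
    exec (While e c) s (eval_cost s e + t1 + t2).+1 s2
| exec_while_false e c s :
    eval s e = 0 ->
    exec (While e c) s (eval_cost s e).+1 s.

Definition load (l : seq int) (k : int) : int :=
  if k is Posz m then nth 0 l m else 0.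

(* The n x n matrix of the values of f on edges, and 0 elsewhere, in row-major
   order. *)
Definition edge_matrix (I : instance)
    (f : 'I_(nvert I) -> 'I_(nvert I) -> int) : seq int :=
  [seq (if edge i j then f i j else 0)
     | i <- enum 'I_(nvert I), j <- enum 'I_(nvert I)].

(* All memory not occupied by the input is 0. *)
Definition input_state (I : instance) : state := fun a =>
  match a with
  | 0 => load [:: (nvert I)%:Z]
  | 1 => load [seq (cap i)%:Z | i <- enum 'I_(nvert I)]
  | 2 => load (edge_matrix (fun i j : 'I_(nvert I) => 1))
  | 3 => load (edge_matrix (fun i j : 'I_(nvert I) => numq (pcost i j)))
  | 4 => load (edge_matrix (fun i j : 'I_(nvert I) => denq (pcost i j)))
  | 5 => load (edge_matrix (fun i j : 'I_(nvert I) => numq (qcost i j)))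
  | 6 => load (edge_matrix (fun i j : 'I_(nvert I) => denq (qcost i j)))
  | _ => fun _ => 0
  end%N.

(* The solution (x, y) is returned in arrays 7 (numerators of x),
   8 (denominators of x) and 9 (y), laid out as the matrices of the input. *)
Definition returns (I : instance) (s : state)
    (x : 'I_(nvert I) -> 'I_(nvert I) -> rat)
    (y : 'I_(nvert I) -> 'I_(nvert I) -> bool) : Prop :=
  forall i j : 'I_(nvert I), edge i j ->
    let k := (i * nvert I + j)%N%:Z in
    [/\ s 7%N k = numq (x i j),
        s 8%N k = denq (x i j)
      & s 9%N k = (y i j : nat)%:Z].

(* Main.v *)
Require Import Defs.
From HB Require Import structures.
From mathcomp Require Import all_boot all_order all_algebra.
From mathcomp Require Import reals.
From mathcomp Require Import zify ring lra.
Set Implicit Arguments.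
Unset Strict Implicit.
Unset Printing Implicit Defensive.
Import Order.TTheory GRing.Theory Num.Theory.
Local Open Scope ring_scope.

(** Root the tree at vertex 0 and list its edges as
    steps (v, u), where the new vertex v is joined to a vertex u found before.
    Undoing the steps from the last to the first gives tables F: F w k is the
    least cost on the edges undone below w if these edges may use k units of
    the capacity of w. Undoing (v, u) replaces the row of u by
      F u k := min over x of F u (k - x) + F v (b v - x) + cost of x on (v, u),
    and the last value F r (b r) at the root r is the least cost of an integral
    solution. There are at most n * (max b + 1) entries.

    Real solutions do no better (tables_lower_bound). Extend each row linearly
    between consecutive integers, and follow an arbitrary real solution from
    the root outwards. The sum of F w over the vertices w found so far, each
    taken at the capacity that w has left, drops in every step by at most the
    cost of the new edge, because the recurrence above survives the linear
    extension (interp_convolution). The sum starts at F r (b r) and ends at 0.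
    This covers the integrality of the flow as well as the choice of y. If each
    step takes the minimizing x, the drop is exactly the cost of the edge
    (tables_backtrack), so that tracing the choices from the root yields a
    solution of cost F r (b r).

    The running time is not counted for this program in particular. It belongs
    to a class of programs (tame) whose loops are bounded by n or by a capacity
    and whose products have a factor that is a constant, an input or a loop
    counter. Each operation then lengthens the stored numbers by at most about
    the length of the input, so that polynomially many operations take
    polynomial time (exec_tame, tame_polynomial_time). A tame program is also a
    total function on states (den), and its correctness is proved about that
    function: discover lists the steps, scale multiplies all costs by a common
    denominator, fill computes the tables and trace reads off the solution. *)

(** * For-programs *)

(** [PFor a e p] evaluates e once, to m, and runs p with the values
    m - 1, ..., 1, 0 of the counter at position 0 of array a. *)
Inductive prog :=
| PSkip
| PSet of nat & expr & expr
| PSeq of prog & prog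
| PIf of expr & prog & prog
| PFor of nat & expr & prog.

Definition counter_guard (a : nat) : expr := Bin Leq (Cst 1) (Get a (Cst 0)).
Definition counter_decr (a : nat) : cmd :=
  Set_ a (Cst 0) (Bin Defs.Sub (Get a (Cst 0)) (Cst 1)).

Fixpoint compile (p : prog) : cmd :=
  match p with
  | PSkip => Skip
  | PSet a e1 e2 => Set_ a e1 e2
  | PSeq p1 p2 => Seq (compile p1) (compile p2)
  | PIf e p1 p2 => If e (compile p1) (compile p2)
  | PFor a e p1 =>
      Seq (Set_ a (Cst 0) e)
          (While (counter_guard a) (Seq (counter_decr a) (compile p1)))
  end.

Fixpoint countdown (f : state -> state) (a m : nat) (s : state) : state :=
  if m is m'.+1 then countdown f a m' (f (update s a 0 m'%:Z)) else s.

Fixpoint den (p : prog) (s : state) : state :=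
  match p with
  | PSkip => s
  | PSet a e1 e2 => update s a (eval s e1) (eval s e2)
  | PSeq p1 p2 => den p2 (den p1 s)
  | PIf e p1 p2 => if eval s e != 0 then den p1 s else den p2 s
  | PFor a e p1 =>
      countdown (den p1) a (absz (eval s e)) (update s a 0 (eval s e))
  end.

Fixpoint writes (p : prog) : seq nat :=
  match p with
  | PSkip => [::]
  | PSet a _ _ => [:: a]
  | PSeq p1 p2 | PIf _ p1 p2 => writes p1 ++ writes p2
  | PFor a _ p1 => a :: writes p1
  end.

(** Arrays 0 to 6 hold the input and arrays from 20 on hold loop counters. Both
    keep their numbers short, while arrays 7 to 19 are working memory. *)
Definition steady (a : nat) : bool := (a < 7)%N || (19 < a)%N.

Definition modest (e : expr) : bool :=
  match e with
  | Cst _ => true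
  | Get a _ => steady a
  | Bin _ _ _ => false
  end.

Fixpoint tame_expr (e : expr) : bool :=
  match e with
  | Cst _ => true
  | Get _ e1 => tame_expr e1
  | Bin o e1 e2 =>
      [&& tame_expr e1, tame_expr e2
        & if o is Mul then modest e1 || modest e2 else true]
  end.

(** Arrays 0 and 1 hold the number of vertices and the capacities, so that these
    bounds are polynomial in the value, and not the length, of the input. *)
Definition range_expr (e : expr) : bool :=
  match e with
  | Get a _ => (a < 2)%N
  | Bin Add (Get a _) (Cst 1) => (a < 2)%N
  | _ => false
  end.

Fixpoint tame (p : prog) : bool :=
  match p with
  | PSkip => true
  | PSet a e1 e2 => [&& ~~ steady a, tame_expr e1 & tame_expr e2]
  | PSeq p1 p2 => tame p1 && tame p2
  | PIf e p1 p2 => [&& tame_expr e, tame p1 & tame p2]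
  | PFor a e p1 =>
      [&& (19 < a)%N, a \notin writes p1, tame_expr e, range_expr e & tame p1]
  end.

(** * Bit lengths *)

Lemma bitsize_leq (z : int) (k : nat) :
  (bitsize z <= k.+1)%N = (absz z < 2 ^ k)%N.
Proof.
rewrite /bitsize ltnS; apply/idP/idP => [le_k | lt_k].
  by apply: leq_trans (up_logP _ (isT : (1 < 2)%N)) _; rewrite leq_exp2l.
exact: up_log_min.
Qed.

Lemma bitsize_lt (z : int) : (absz z < 2 ^ (bitsize z).-1)%N.
Proof. by rewrite -bitsize_leq. Qed.

Lemma bitsize_absz (z : int) : (bitsize z <= (absz z).+1)%N.
Proof. by rewrite bitsize_leq ltn_expl. Qed.

Lemma bitsize_add (k : nat) (u v : int) :
  (bitsize u <= k -> bitsize v <= k -> bitsize (u + v)%R <= k.+1)%N.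
Proof.
case: k => // k; rewrite !bitsize_leq expnS => u_k v_k; lia.
Qed.

Lemma bitsize_opp (u : int) : bitsize (- u) = bitsize u.
Proof. by rewrite /bitsize abszN. Qed.

Lemma bitsize_mul (u v : int) : (bitsize (u * v)%R <= bitsize u + bitsize v)%N.
Proof.
have -> : (bitsize u + bitsize v = ((bitsize u).-1 + (bitsize v).-1).+2)%N.
  by rewrite -addSn -addnS.
apply: leqW; rewrite bitsize_leq abszM expnD.
exact: ltn_mul (bitsize_lt u) (bitsize_lt v).
Qed.

Lemma bitsize_bool (b : bool) : (bitsize (b : nat)%:Z <= 2)%N.
Proof. by rewrite bitsize_leq; case: b. Qed.

Lemma bitsize_le_nat (m n : nat) : (m <= n)%N -> (bitsize m%:Z <= bitsize n%:Z)%N.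
Proof. by move=> le_mn; rewrite /bitsize ltnS leq_up_log. Qed.

(** * For-programs run in polynomial time *)

Fixpoint expr_size (e : expr) : nat :=
  match e with
  | Cst z => bitsize z
  | Get _ e1 => (expr_size e1).+1
  | Bin _ e1 e2 => (expr_size e1 + expr_size e2).+2
  end.

(** N bounds the values that limit loops, L0 the lengths of inputs and counters,
    and L, which grows during a run, the lengths of all numbers. *)
Definition bounded (N L0 L : nat) (s : state) : Prop :=
  [/\ forall a k, (bitsize (s a k) <= L)%N,
      forall a k, steady a -> (bitsize (s a k) <= L0)%N
    & forall a k, (a < 2)%N -> 0 <= s a k <= N%:Z].

Lemma modest_bits N L0 L s e :
  bounded N L0 L s -> modest e -> (bitsize (eval s e) <= L0 + expr_size e)%N.
Proof.
move=> [_ s_steady _]; case: e => //= [z _ | a e1 /s_steady s_a]; first exact: leq_addl.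
by apply: leq_trans (s_a _) _; apply: leq_addr.
Qed.

(** A product lengthens its other factor by the length of the modest one only, so
    that nested operations add up instead of multiplying. *)
Lemma eval_bits N L0 L s e :
  bounded N L0 L s -> tame_expr e ->
  (bitsize (eval s e) <= L + expr_size e * L0.+1)%N.
Proof.
move=> bs; have [s_L _ _] := bs.
elim: e => [z | a e1 _ | o e1 IH1 e2 IH2] /=.
- by move=> _; nia.
- by move=> _; apply: leq_trans (s_L _ _) _; apply: leq_addr.
move=> /and3P[/IH1 {}IH1 /IH2 {}IH2].
set m := expr_size e1 in IH1 *; set n := expr_size e2 in IH2 *.
have le1 : (L + m * L0.+1 <= L + (m + n) * L0.+1)%N by nia.
have le2 : (L + n * L0.+1 <= L + (m + n) * L0.+1)%N by nia.
have add_bits u v : (bitsize u <= L + m * L0.+1 -> bitsize v <= L + n * L0.+1 ->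
    bitsize (u + v)%R <= L + (m + n).+2 * L0.+1)%N.
  move=> bu bv; apply: leq_trans (bitsize_add (leq_trans bu le1) (leq_trans bv le2)) _.
  by nia.
case: o => /=; rewrite -/m -/n.
- by move=> _; apply: add_bits.
- by move=> _; apply: add_bits; rewrite ?bitsize_opp.
- move=> small; apply: leq_trans (bitsize_mul _ _) _.
  case/orP: small => /(modest_bits bs); rewrite -/m -/n; nia.
- by move=> _; apply: leq_trans (bitsize_bool _) _; nia.
Qed.

Lemma eval_time N L0 L U s e :
  bounded N L0 L s -> tame_expr e -> (L + expr_size e * L0.+1 <= U)%N ->
  (eval_cost s e <= 3 * expr_size e * U)%N.
Proof.
move=> bs te leU; have [s_L _ _] := bs.
elim: e te leU => [z | a e1 IH1 | o e1 IH1 e2 IH2] /=.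
- by move=> _; nia.
- move=> te leU; have := eval_bits bs te; have := s_L a (eval s e1).
  have := IH1 te; nia.
move=> /and3P[te1 te2 _] leU; have := eval_bits bs te1; have := eval_bits bs te2.
have := IH1 te1; have := IH2 te2; nia.
Qed.

Lemma bounded_set_counter N L0 L s a v :
  bounded N L0 L s -> (19 < a)%N -> (L0 <= L)%N -> (bitsize v <= L0)%N ->
  bounded N L0 L (update s a 0 v).
Proof.
move=> [s_L s_st s_N] lt_a le_L v_L0; split=> a' k; rewrite /update.
- by case: ifP => _ //; apply: leq_trans le_L.
- by case: ifP => _ // /s_st.
- by case: eqP => [-> | _] lt2 /=; [lia | apply: s_N].
Qed.

Lemma bounded_widen N L0 L L' s :
  bounded N L0 L s -> (L <= L')%N -> bounded N L0 L' s.
Proof. by move=> [s_L s_st s_N] leL; split=> // a k; apply: leq_trans leL. Qed.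

Lemma range_expr_bounds N L0 L s e :
  bounded N L0 L s -> range_expr e ->
  exists2 m, eval s e = Posz m & (m <= N.+1)%N.
Proof.
move=> [_ _ s_N]; have get a e1 : (a < 2)%N ->
    exists2 m, eval s (Get a e1) = Posz m & (m <= N)%N.
  move=> /(s_N a (eval s e1)) /=; case: (s a _) => // m.
  by move=> h; exists m => //; move: h; lia.
case: e => // [a e1 lt_a|].
  by have [m e_m le_m] := get a e1 lt_a; exists m => //; lia.
case=> // -[] // a e1 [] // [] // [|[]] //= lt_a.
have [m /= -> le_m] := get _ e1 lt_a.
by exists m.+1; [rewrite /=; lia | lia].
Qed.

Lemma countdown_frame f a m s b k :
  a != b -> (forall s', f s' b k = s' b k) -> countdown f a m s b k = s b k.
Proof.
move=> ab fb; elim: m s => //= m IH s; rewrite IH fb /update.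
by rewrite eq_sym (negbTE ab).
Qed.

Lemma den_frame p s a k : a \notin writes p -> den p s a k = s a k.
Proof.
elim: p s => //= [b e1 e2 | p1 IH1 p2 IH2 | e p1 IH1 p2 IH2 | b e p1 IH1] s.
- by rewrite inE /update => /negbTE->.
- by rewrite mem_cat negb_or => /andP[h1 h2]; rewrite IH2 // IH1.
- by rewrite mem_cat negb_or => /andP[h1 h2]; case: ifP => _; rewrite ?IH2 // IH1.
rewrite inE negb_or => /andP[ab h1]; rewrite countdown_frame; last by move=> s'; apply: IH1.
  by rewrite /update (negbTE ab).
by rewrite eq_sym.
Qed.

(** An upper bound both for the time, in units of the largest number length,
    and for the growth of that length, in units of L0 + 1. Every loop
    makes at most N + 1 rounds; 40 and 60 pay for its counter and guard. *)
Fixpoint work (N : nat) (p : prog) : nat :=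
  match p with
  | PSkip => 1
  | PSet _ e1 e2 => (3 * (expr_size e1 + expr_size e2) + 2)%N
  | PSeq p1 p2 => (work N p1 + work N p2).+1
  | PIf e p1 p2 => (3 * expr_size e + work N p1 + work N p2).+1
  | PFor a e p1 => (3 * expr_size e + 40 + N.+1 * (work N p1 + 60))%N
  end.

Lemma work_poly p :
  exists c d, forall N, (work N p <= c * N.+1 ^ d)%N.
Proof.
have mono (N c d d' : nat) : (d <= d' -> c * N.+1 ^ d <= c * N.+1 ^ d')%N.
  by move=> le_d; rewrite leq_mul2l leq_pexp2l ?orbT.
elim: p => /= [| a e1 e2 | p1 [c1 [d1 h1]] p2 [c2 [d2 h2]]
  | e p1 [c1 [d1 h1]] p2 [c2 [d2 h2]] | a e p1 [c1 [d1 h1]]].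
- by exists 1%N, 0%N.
- by exists (3 * (expr_size e1 + expr_size e2) + 2)%N, 0%N => N; rewrite expn0 muln1.
- exists (c1 + c2 + 1)%N, (maxn d1 d2) => N.
  have := leq_trans (h1 N) (mono N c1 _ _ (leq_maxl d1 d2)).
  have := leq_trans (h2 N) (mono N c2 _ _ (leq_maxr d1 d2)).
  have : (0 < N.+1 ^ maxn d1 d2)%N by rewrite expn_gt0.
  nia.
- exists (3 * expr_size e + c1 + c2 + 1)%N, (maxn d1 d2) => N.
  have := leq_trans (h1 N) (mono N c1 _ _ (leq_maxl d1 d2)).
  have := leq_trans (h2 N) (mono N c2 _ _ (leq_maxr d1 d2)).
  have : (0 < N.+1 ^ maxn d1 d2)%N by rewrite expn_gt0.
  nia.
exists (3 * expr_size e + 40 + c1 + 60)%N, d1.+1 => N.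
have := h1 N; rewrite expnS.
have : (0 < N.+1 ^ d1)%N by rewrite expn_gt0.
set z := (N.+1 ^ d1)%N; set w := work N p1; set m := expr_size e => z_gt0 le_w.
have : (N.+1 * w <= N.+1 * (c1 * z))%N by rewrite leq_mul2l le_w orbT.
have : (N.+1 <= N.+1 * z)%N by nia.
rewrite mulnCA; set x := (N.+1 * z)%N => le1 le2.
rewrite mulnDr; nia.
Qed.

(** Counters have lengths of at most L0, so that only the runs of the body lengthen numbers.
    U bounds all lengths at the end of the run, hence the price of each
    operation during it. *)
Lemma exec_For N L0 L U a e p s :
  (forall s' L', bounded N L0 L' s' -> (L0 <= L')%N ->
     (L' + work N p * L0.+1 <= U)%N ->
     exists2 t, exec (compile p) s' t (den p s') & (t <= work N p * U)%N /\
       bounded N L0 (L' + work N p * L0.+1) (den p s')) ->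
  tame (PFor a e p) -> (bitsize N.+1%:Z <= L0)%N ->
  bounded N L0 L s -> (L0 <= L)%N -> (L + work N (PFor a e p) * L0.+1 <= U)%N ->
  exists2 t, exec (compile (PFor a e p)) s t (den (PFor a e p) s) &
    (t <= work N (PFor a e p) * U)%N /\
    bounded N L0 (L + work N (PFor a e p) * L0.+1) (den (PFor a e p) s).
Proof.
move=> IHp /= /and5P[lt_a a_p te re tp] N_L0 bs le_L leU.
have [m e_m le_m] := range_expr_bounds bs re.
set w := work N p in IHp leU *; set M := L0.+1 in IHp leU *.
have bits_m (i : nat) : (i <= N.+1)%N -> (bitsize i%:Z <= L0)%N.
  by move=> le_i; apply: leq_trans (bitsize_le_nat le_i) N_L0.
pose pred_a := Bin Defs.Sub (Get a (Cst 0)) (Cst 1).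
have head_time L' s' : bounded N L0 L' s' -> (L' + 40 * M <= U)%N ->
    (eval_cost s' (counter_guard a) <= 18 * U)%N /\ (eval_cost s' pred_a <= 18 * U)%N.
  move=> bs' leU'.
  by split; apply: (eval_time bs') => //; apply: leq_trans leU';
     rewrite leq_add2l leq_mul2r.
have loop (i : nat) L' s' : (i <= N.+1)%N -> bounded N L0 L' s' -> (L0 <= L')%N ->
    (L' + (i * w + 40) * M <= U)%N -> s' a 0 = i%:Z ->
    exists2 t, exec (While (counter_guard a) (Seq (counter_decr a) (compile p)))
                 s' t (countdown (den p) a i s') &
      (t <= (i * (w + 60) + 30) * U)%N /\
      bounded N L0 (L' + i * w * M) (countdown (den p) a i s').
  elim: i L' s' => [|i IHi] L' s' le_i bs' le_L' leU' s'_a.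
    have guard : eval s' (counter_guard a) = 0 by rewrite /= s'_a.
    exists (eval_cost s' (counter_guard a)).+1; first exact: exec_while_false.
    split; last by apply: bounded_widen bs' _; apply: leq_addr.
    have [] := head_time L' s' bs' leU'; have : (0 < U)%N by nia.
    nia.
  have guard : eval s' (counter_guard a) != 0 by rewrite /= s'_a.
  have bs1 := bounded_set_counter bs' lt_a le_L' (bits_m i (ltnW le_i)).
  have [||t et [le_t bs2]] := IHp _ _ bs1 => //.
    by apply: leq_trans leU'; rewrite /M; nia.
  have s2_a : den p (update s' a 0 i%:Z) a 0 = i%:Z.
    by rewrite den_frame // /update !eqxx.
  have [||||t' et' [le_t' bs3]] := IHi _ _ _ bs2 => //.
  - exact: ltnW.
  - by apply: leq_trans le_L' _; apply: leq_addr.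
  - by apply: leq_trans leU'; rewrite -addnA leq_add2l -mulnDl leq_mul2r; apply/orP;
    right; nia.
  have decr : eval s' pred_a = i%:Z.
    by rewrite /= s'_a; lia.
  have e1 : exec (counter_decr a) s'
      (eval_cost s' (Cst 0) + eval_cost s' pred_a
       + bitsize 0 + bitsize i%:Z)%N (update s' a 0 i%:Z).
    by rewrite -decr; apply: exec_set.
  eexists.
    apply: exec_while_true guard _ et'.
    exact: exec_seq e1 et.
  split; last first.
    by move: bs3; rewrite -addnA -mulnDl (_ : w + i * w = i.+1 * w)%N.
  have leU40 : (L' + 40 * M <= U)%N by apply: leq_trans leU'; nia.
  have [] := head_time L' s' bs' leU40; rewrite -/pred_a.
  rewrite (_ : eval_cost s' (Cst 0) = 1%N) // (_ : bitsize 0 = 1%N) //.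
  have := bits_m i (ltnW le_i).
  set c1 := eval_cost _ _; set c2 := eval_cost _ _; set b1 := bitsize _ => h1 h2 h3.
  have U_gt0 : (0 < U)%N by nia.
  have : (b1 <= U)%N by apply: leq_trans h1 _; apply: leq_trans le_L' _; nia.
  move: le_t le_t'; rewrite -/w mulSn; set x := (i * (w + 60))%N.
  rewrite !mulnDl; nia.
have e1 : exec (Set_ a (Cst 0) e) s
    (eval_cost s (Cst 0) + eval_cost s e + bitsize 0 + bitsize m%:Z)%N
    (update s a 0 m%:Z).
  by rewrite -e_m; apply: exec_set.
have bs1 := bounded_set_counter bs lt_a le_L (bits_m m le_m).
have w_for : (m * w + 40 <= 3 * expr_size e + 40 + N.+1 * (w + 60))%N.
  by have : (m * w <= N.+1 * (w + 60))%N; [apply: leq_mul; lia | lia].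
have [|||t et [le_t bs2]] := loop m L (update s a 0 m%:Z) le_m bs1 => //.
- by apply: leq_trans leU; rewrite leq_add2l leq_mul2r w_for orbT.
- by rewrite /update !eqxx.
rewrite e_m /=; eexists; first exact: exec_seq e1 et.
split; last first.
  by apply: bounded_widen bs2 _; rewrite leq_add2l leq_mul2r; apply/orP; right; lia.
have : (L + expr_size e * M <= U)%N.
  by apply: leq_trans leU; rewrite leq_add2l leq_mul2r; apply/orP; right; nia.
move=> /(eval_time bs te).
rewrite (_ : bitsize 0 = 1%N) // (_ : eval_cost s (Cst 0) = 1%N) //=.
have : (bitsize m%:Z <= U)%N.
  by apply: leq_trans (bits_m _ le_m) _; apply: leq_trans leU; apply: leq_trans le_L _;
    apply: leq_addr.
have U_gt0 : (0 < U)%N.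
  by apply: leq_trans leU; rewrite addn_gt0 muln_gt0 addn_gt0 addn_gt0 !orbT.
have : (m * (w + 60) * U <= N.+1 * (w + 60) * U)%N.
  by rewrite !leq_mul2r le_m !orbT.
move: le_t; rewrite -/w; set x := (m * (w + 60))%N; set y := (N.+1 * (w + 60))%N.
set b1 := bitsize _; rewrite !mulnDl; nia.
Qed.

(** A state grows by at most L0 + 1 bits per unit of work, and each unit of
    work handles boundedly many numbers, each of length at most U. *)
Theorem exec_tame N L0 L U p s :
  tame p -> (bitsize N.+1%:Z <= L0)%N ->
  bounded N L0 L s -> (L0 <= L)%N -> (L + work N p * L0.+1 <= U)%N ->
  exists2 t, exec (compile p) s t (den p s) & (t <= work N p * U)%N /\
    bounded N L0 (L + work N p * L0.+1) (den p s).
Proof.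
move=> tp N_L0; elim: p tp L s => [| a e1 e2 | p1 IH1 p2 IH2 | e p1 IH1 p2 IH2 | a e p1
  IH1].
- move=> _ L s bs le_L leU; exists 1%N; first exact: exec_skip.
  split; first by move: leU; rewrite /=; nia.
  by apply: bounded_widen bs _; rewrite /=; apply: leq_addr.
- move=> /= /and3P[a_free te1 te2] L s bs le_L.
  set m1 := expr_size e1; set m2 := expr_size e2 => leU.
  have leU1 : (L + m1 * L0.+1 <= U)%N by apply: leq_trans leU; nia.
  have leU2 : (L + m2 * L0.+1 <= U)%N by apply: leq_trans leU; nia.
  have bits1 := eval_bits bs te1; have bits2 := eval_bits bs te2.
  have time1 := eval_time bs te1 leU1; have time2 := eval_time bs te2 leU2.
  rewrite -/m1 -/m2 in bits1 bits2 time1 time2.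
  eexists; first exact: exec_set.
  split; first by nia.
  have le2 : (L + m2 * L0.+1 <= L + (3 * (m1 + m2) + 2) * L0.+1)%N by nia.
  have [s_L s_st s_N] := bs; move: a_free; rewrite /steady negb_or -!leqNgt => /andP[lo hi].
  split=> a' k; rewrite /update.
  + case: ifP => _; first exact: leq_trans bits2 le2.
    by apply: leq_trans (s_L _ _) _; apply: leq_addr.
  + by case: eqP => [-> | _] /=; [rewrite /steady; lia | apply: s_st].
  + by case: eqP => [-> | _] /= lt2; [lia | apply: s_N].
- move=> /= /andP[t1 t2] L s bs le_L leU.
  have [||u1 eu1 [le1 bs1]] := IH1 t1 L s bs => //; first by apply: leq_trans leU; nia.
  have [||u2 eu2 [le2 bs2]] := IH2 t2 _ _ bs1; first by nia.
    by apply: leq_trans leU; nia.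
  exists (u1 + u2).+1; first exact: exec_seq eu1 eu2.
  have U_gt0 : (0 < U)%N by nia.
  split; first by rewrite mulSn mulnDl; lia.
  by apply: bounded_widen bs2 _; nia.
- move=> /= /and3P[te t1 t2] L s bs le_L leU.
  have time := eval_time bs te (_ : L + expr_size e * L0.+1 <= U)%N.
  have {}time : (eval_cost s e <= 3 * expr_size e * U)%N.
    by apply: time; apply: leq_trans leU; nia.
  have U_gt0 : (0 < U)%N by nia.
  case: eqP => [e0 | /eqP e0] /=.
    have [||u eu [le_u bs']] := IH2 t2 L s bs => //; first by apply: leq_trans leU; nia.
    exists (eval_cost s e + u).+1; first exact: exec_if_false.
    split; first by nia.
    by apply: bounded_widen bs' _; nia.
  have [||u eu [le_u bs']] := IH1 t1 L s bs => //; first by apply: leq_trans leU; nia.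
  exists (eval_cost s e + u).+1; first exact: exec_if_true.
  split; first by nia.
  by apply: bounded_widen bs' _; nia.
move=> tp L s bs le_L leU; apply: exec_For => //.
by move=> s' L'; apply: IH1; case/and5P: tp.
Qed.

Lemma load_ind (P : int -> Prop) l k :
  P 0 -> (forall z, z \in l -> P z) -> P (load l k).
Proof.
move=> P0 Pl; case: k => //= m; case: (ltnP m (size l)) => [lt_m | le_m].
  exact/Pl/mem_nth.
by rewrite nth_default.
Qed.

Lemma edge_matrix_ind (P : int -> Prop) (I : instance) f k :
  P 0 -> (forall i j : 'I_(nvert I), edge i j -> P (f i j)) ->
  P (load (edge_matrix f) k).
Proof.
move=> P0 Pf; apply: load_ind => // z /allpairsP[[i j] [_ _ ->]] /=.
by case: ifP => // /Pf.
Qed.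

(** The encoding length counts an edge in the direction i < j alone; the symmetry
    of the costs covers the other direction. *)
Lemma edge_length_le (I : instance) (i j : 'I_(nvert I)) :
  tree_instance I -> edge i j ->
  (rat_length (pcost i j) + rat_length (qcost i j) <= cost_length I)%N.
Proof.
move=> [[_ e_sym e_irr _ _] p_sym q_sym].
have up (u v : 'I_(nvert I)) : (u < v)%N -> edge u v ->
    (rat_length (pcost u v) + rat_length (qcost u v) <= cost_length I)%N.
  move=> lt_uv e_uv; rewrite /cost_length (bigD1 u) //= (bigD1 v) ?lt_uv //=.
  by rewrite -addnA leq_addr.
move=> e_ij; case: (ltngtP i j) => [lt_ij | lt_ji | /val_inj eq_ij].
- exact: up.
- by rewrite p_sym // q_sym //; apply: up; rewrite // e_sym.
- by move: e_ij; rewrite eq_ij e_irr.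
Qed.

Lemma bounded_input (I : instance) :
  tree_instance I ->
  let Z := (nvert I + max_cap I + cost_length I)%N in
  bounded Z Z.+2 Z.+2 (input_state I).
Proof.
move=> treeI Z.
have le_cap (i : 'I_(nvert I)) : (cap i <= max_cap I)%N by apply: leq_bigmax.
have bits_nat m : (m <= Z)%N -> (bitsize m%:Z <= Z.+2)%N.
  by move=> le_m; apply: leq_trans (bitsize_absz _) _; rewrite /= ltnW // !ltnS.
have bits_e (i j : 'I_(nvert I)) : edge i j ->
    [/\ bitsize (numq (pcost i j)) <= Z.+2, bitsize (denq (pcost i j)) <= Z.+2,
        bitsize (numq (qcost i j)) <= Z.+2 & bitsize (denq (qcost i j)) <= Z.+2]%N.
  by move=> /(edge_length_le treeI); rewrite /rat_length /Z; split; lia.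
pose short (z : int) := (bitsize z <= Z.+2)%N.
have bits a k : short (input_state I a k).
  have bits0 : short 0 by [].
  case: a => [|[|[|[|[|[|[|a]]]]]]] //=.
  - by apply: (load_ind (P := short)) => // z; rewrite inE => /eqP->; apply: bits_nat;
    rewrite /Z; lia.
  - apply: (load_ind (P := short)) => // z /mapP[i _ ->]; apply: bits_nat.
    by have := le_cap i; rewrite /Z; lia.
  - by apply: (edge_matrix_ind (P := short)).
  - by apply: (edge_matrix_ind (P := short)) => // i j /bits_e[].
  - by apply: (edge_matrix_ind (P := short)) => // i j /bits_e[].
  - by apply: (edge_matrix_ind (P := short)) => // i j /bits_e[].
  - by apply: (edge_matrix_ind (P := short)) => // i j /bits_e[].
pose fits (z : int) := 0 <= z <= Z%:Z.
split; [exact: bits | by move=> a k _; apply: bits | ].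
move=> [|[|a]] k // _; rewrite -/(fits _) /=.
- by apply: (load_ind (P := fits)) => // z; rewrite inE => /eqP->; rewrite /fits /Z; lia.
- apply: (load_ind (P := fits)) => // z /mapP[i _ ->].
  by have := le_cap i; rewrite /fits /Z; lia.
Qed.

Theorem tame_polynomial_time (p : prog) :
  tame p ->
  exists c k, forall I : instance, tree_instance I ->
  exists2 t, exec (compile p) (input_state I) t (den p (input_state I)) &
    (t <= c * (nvert I + max_cap I + cost_length I) ^ k)%N.
Proof.
move=> tp; have [c [d work_le]] := work_poly p.
exists (c * 2 ^ d * (4 + c * 2 ^ d * 4))%N, (d + (d + 1))%N => I treeI.
have := bounded_input treeI.
have: (0 < nvert I + max_cap I + cost_length I)%N.
  by case: treeI => -[n_gt0 _ _ _ _] _ _; lia.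
set Z := (_ + _ + _)%N => Z_gt0 bs.
have Z_bits : (bitsize Z.+1%:Z <= Z.+2)%N by apply: bitsize_absz.
have [t et [le_t _]] := exec_tame tp Z_bits bs (leqnn _) (leqnn _).
exists t => //; apply: leq_trans le_t _.
have {}work_le : (work Z p <= c * 2 ^ d * Z ^ d)%N.
  apply: leq_trans (work_le Z) _; rewrite -mulnA -expnMn leq_mul2l; apply/orP; right.
  by case: (d) => // d'; rewrite leq_exp2r //; lia.
rewrite !expnD expn1 mulnACA; apply: leq_mul => //.
have Zd_gt0 : (0 < Z ^ d)%N by rewrite expn_gt0 Z_gt0.
rewrite mulnDl; apply: leq_add; first by nia.
rewrite mulnACA; apply: leq_mul => //; lia.
Qed.

(** * Interpolation of integer tables *)

Definition interp (R : archiRealFieldType) (f : nat -> int) (z : R) : R :=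
  let k := Num.truncn z in
  (f k)%:~R + (z - k%:R) * ((f k.+1)%:~R - (f k)%:~R).

(** The case l = 1, in which the floor is k.+1, agrees with the formula at k and
    is needed when two fractional parts add up to 1. *)
Lemma interpE (R : archiRealFieldType) (f : nat -> int) (k : nat) (l : R) :
  0 <= l <= 1 ->
  interp f (k%:R + l) = (1 - l) * (f k)%:~R + l * (f k.+1)%:~R.
Proof.
move=> /andP[l0 l1]; rewrite /interp; have [l_1 | l_lt1] := eqVneq l 1.
  have -> : k%:R + l = k.+1%:R :> R by rewrite l_1 -natr1.
  by rewrite Num.Theory.natrK l_1; ring.
have -> : Num.truncn (k%:R + l) = k.
  apply: Num.Theory.truncn_def; rewrite lerDl l0 -natr1 ltrD2l.
  by rewrite lt_neqAle l_lt1.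
by ring.
Qed.

Lemma interp_nat (R : archiRealFieldType) (f : nat -> int) (k : nat) :
  interp f (k%:R : R) = (f k)%:~R.
Proof. by rewrite -[k%:R]addr0 interpE ?lexx ?ler01 //; ring. Qed.

Lemma nat_frac (R : archiRealFieldType) (z : R) :
  0 <= z -> exists k l, z = k%:R + l /\ 0 <= l < 1.
Proof.
move=> z0; exists (Num.truncn z), (z - (Num.truncn z)%:R).
split; first by rewrite addrC subrK.
have /andP[le_z lt_z] := Num.Theory.truncn_itv z0.
by rewrite subr_ge0 le_z /= ltrBlDl natr1.
Qed.

(** The argument needs no convexity of the tables, only their linearity between
    integers. The fractional parts (l, r) of z and x lie in one of the two
    triangles into which the diagonal l + r = 1 cuts the unit square. The sums
    of the corners of a triangle are consecutive integers around z + x, and the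
    barycentric weights of (l, r) are those that interpolate h at z + x. A corner
    of weight 0 may violate j <= b. *)
Lemma interp_convolution (R : archiRealFieldType) (f g h : nat -> int) (b : nat)
    (z x : R) :
  (forall i j, (j <= b)%N -> h (i + j)%N <= f i + g j) ->
  0 <= z -> 0 <= x <= b%:R -> interp h (z + x) <= interp f z + interp g x.
Proof.
move=> hfg z0 /andP[x0 xb].
have [k [l [-> /andP[l0 l1]]]] := nat_frac z0.
have [m [r [def_x /andP[r0 r1]]]] := nat_frac x0.
have hR i j : (j <= b)%N -> 0 <= (f i)%:~R + (g j)%:~R - (h (i + j)%N)%:~R :> R.
  by move=> /hfg le_h; rewrite subr_ge0 -rmorphD ler_int.
have le_m : (m <= b)%N.
  by rewrite -(ler_nat R); apply: le_trans xb; rewrite def_x lerDl.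
have weight (c : R) (i : nat) : 0 <= c -> c <= r ->
    0 <= c * ((f i)%:~R + (g m.+1)%:~R - (h (i + m.+1)%N)%:~R).
  move=> c0 cr; have [-> | c_neq0] := eqVneq c 0; first by rewrite mul0r.
  apply: mulr_ge0 => //; apply: hR; rewrite -(ltr_nat R); apply: lt_le_trans xb.
  by rewrite def_x ltrDl; apply: lt_le_trans cr; rewrite lt_def c_neq0.
have l01 : 0 <= l <= 1 by rewrite l0 ltW.
have r01 : 0 <= r <= 1 by rewrite r0 ltW.
rewrite def_x (interpE f k l01) (interpE g m r01) -subr_ge0.
have sumE : k%:R + l + (m%:R + r) = (k + m)%:R + (l + r) :> R by rewrite natrD; ring.
have [lr1 | lr1] := lerP (l + r) 1.
  rewrite sumE interpE; last by rewrite lr1 addr_ge0.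
  have w0 : 0 <= 1 - (l + r) by rewrite subr_ge0.
  have := addr_ge0 (addr_ge0 (mulr_ge0 w0 (hR k m le_m)) (mulr_ge0 l0 (hR k.+1 m le_m)))
    (weight r k r0 (lexx _)).
  by rewrite addnS addSn; congr (0 <= _); ring.
have -> : k%:R + l + (m%:R + r) = (k + m).+1%:R + (l + r - 1) :> R.
  by rewrite sumE -natr1; ring.
rewrite interpE; last by rewrite subr_ge0 (ltW lr1) /=; lra.
have [w0 [w1 w1r] [w2 w2r]] : [/\ 0 <= 1 - r, 0 <= 1 - l /\ 1 - l <= r
    & 0 <= l + r - 1 /\ l + r - 1 <= r] by split; try split; lra.
have := addr_ge0 (addr_ge0 (mulr_ge0 w0 (hR k.+1 m le_m)) (weight (1 - l) k w1 w1r))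
  (weight (l + r - 1) k.+1 w2 w2r).
by rewrite !addnS !addSn; congr (0 <= _); ring.
Qed.

Lemma interp_reflect (R : archiRealFieldType) (f : nat -> int) (c d : int)
    (b : nat) (x : R) :
  0 <= x <= b%:R ->
  interp (fun j => f (b - j)%N + (c * j%:Z + d)) x =
    interp f (b%:R - x) + (c%:~R * x + d%:~R).
Proof.
move=> /andP[x0 xb]; have [k [l [def_x /andP[l0 l1]]]] := nat_frac x0.
have l01 : 0 <= l <= 1 by rewrite l0 ltW.
rewrite def_x interpE // !rmorphD !rmorphM /= -!pmulrn -natr1.
have [l_0 | l_neq0] := eqVneq l 0.
  have le_k : (k <= b)%N by rewrite -(ler_nat R); move: xb; rewrite def_x l_0 addr0.
  by rewrite l_0 addr0 -natrB // interp_nat; ring.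
have lt_k : (k < b)%N.
  rewrite -(ltr_nat R); apply: lt_le_trans xb.
  by rewrite def_x ltrDl lt_def l_neq0.
have -> : b%:R - (k%:R + l) = (b - k.+1)%:R + (1 - l) :> R.
  by rewrite natrB // -natr1; ring.
rewrite interpE; last by lra.
rewrite -subSn // subSS; ring.
Qed.

(** * The dynamic program *)

Section DynamicProgram.
Variables (V : eqType) (b : V -> nat) (P Q : V -> V -> int).
Implicit Types (F : V -> nat -> int) (A : seq V) (st : seq (V * V)).

(** The charge for x units with the better choice of y: a positive flow needs
    y = 1, and without flow y = 1 pays only if it is rewarded. *)
Definition edge_cost (v u : V) (x : nat) : int :=
  if x == 0%N then Num.min 0 (Q v u) else P v u * x%:Z + Q v u.

(** The flow x on the edge from v to u leaves k - x at u and b v - x at v. *)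
Definition split_cost F (v u : V) (k x : nat) : int :=
  F u (k - x)%N + F v (b v - x)%N + edge_cost v u x.

Definition best_split F (v u : V) (k : nat) : nat :=
  [arg min_(x < (ord0 : 'I_(minn k (b v)).+1)) split_cost F v u k x]%O.

Definition attach F (v u : V) : V -> nat -> int := fun w k =>
  if w == u then split_cost F v u k (best_split F v u k) else F w k.

(** [tables st w k] is the least cost on the edges of st beyond w if those at w
    carry at most k units together. A step is followed in the list by
    those that grow from its new vertex, so the end of the list is undone
    first. *)
Fixpoint tables st : V -> nat -> int :=
  if st is (v, u) :: r then attach (tables r) v u else fun _ _ => 0.

Fixpoint grows A st : bool :=
  if st is (v, u) :: r then [&& u \in A, v \notin A & grows (v :: A) r] else true.

Lemma best_splitP F v u k :
  [/\ (best_split F v u k <= k)%N, (best_split F v u k <= b v)%N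
    & forall x, (x <= k)%N -> (x <= b v)%N ->
        split_cost F v u k (best_split F v u k) <= split_cost F v u k x].
Proof.
rewrite /best_split; case: Order.TotalTheory.arg_minP => //= i _ le_i.
have := ltn_ord i; rewrite ltnS leq_min => /andP[ik ib]; split=> // x xk xb.
have lt_x : (x < (minn k (b v)).+1)%N by rewrite ltnS leq_min xk.
exact: (le_i (Ordinal lt_x)).
Qed.

Lemma edge_cost_le v u x : edge_cost v u x <= P v u * x%:Z + Q v u.
Proof.
by rewrite /edge_cost; case: eqP => // ->; rewrite mulr0 add0r ge_min lexx orbT.
Qed.

Lemma edge_cost0_le v u : edge_cost v u 0 <= 0.
Proof. by rewrite /edge_cost eqxx ge_min lexx. Qed.

(** How a potential changes when v joins A: only the terms at u and v do. *)
Lemma sum_extend (T : zmodType) (G G' : V -> T) A v u :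
  uniq A -> u \in A -> v \notin A ->
  (forall w, w != u -> w != v -> G w = G' w) ->
  \sum_(w <- A) G w + (G' u + G' v) = \sum_(w <- v :: A) G' w + G u.
Proof.
move=> uA Au vA GG'; rewrite big_cons !(big_rem u Au) /=.
rewrite (eq_big_seq G') => [|w]; first by rewrite [LHS](AC (2*2) (4*(3*2)*1)).
rewrite mem_rem_uniq // inE => /andP[wu wA]; apply: GG' => //.
by apply: contraNneq vA => <-.
Qed.

Definition incident (w : V) (p : V * V) : bool := (p.1 == w) || (p.2 == w).

Section Relaxation.
Variables (R : archiRealFieldType) (x : V -> V -> R) (y : V -> V -> bool).

Definition step_cost (p : V * V) : R :=
  (P p.1 p.2)%:~R * x p.1 p.2 + (Q p.1 p.2)%:~R * (y p.1 p.2)%:R.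

(** With y = 0 there is no flow and the candidate x = 0 decides; with y = 1 the
    edge cost is linear in the flow and joins the row of v before the
    convolution. *)
Lemma attach_step_le F v u (k : R) :
  0 <= x v u -> (~~ y v u -> x v u = 0) -> x v u <= k -> x v u <= (b v)%:R ->
  interp (attach F v u u) k <=
    interp (F u) (k - x v u) + interp (F v) ((b v)%:R - x v u) + step_cost (v, u).
Proof.
move=> x0 yx xk xb; rewrite -[X in interp _ X <= _](subrK (x v u)).
have kx0 : 0 <= k - x v u by rewrite subr_ge0.
have x_range : 0 <= x v u <= (b v)%:R by rewrite x0.
have best i j c : (j <= b v)%N -> edge_cost v u j <= c ->
    attach F v u u (i + j)%N <= F u i + (F v (b v - j)%N + c).
  move=> jb cost_j; rewrite /attach eqxx.
  have [_ _ le_best] := best_splitP F v u (i + j).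
  apply: le_trans (le_best j (leq_addl _ _) jb) _.
  by rewrite /split_cost addnK -addrA lerD2l lerD2l.
rewrite /step_cost /=; case: (y v u) yx => [_ | x_0]; last move: (x_0 isT) => {}x_0.
  rewrite /= mulr1 -[leRHS]addrA -interp_reflect //.
  by apply: interp_convolution x_range => // i j jb; apply: best (edge_cost_le _ _ _).
rewrite x_0 !subr0 !addr0 !mulr0 addr0 in kx0 *.
have := @interp_convolution R (F u) (fun j => F v (b v - j)%N + (0 * j%:Z + 0))
  (attach F v u u) 0 k 0.
rewrite (@interp_reflect _ _ 0 0 (b v)) ?lexx ?ler0n // subr0 !addr0 mulr0 addr0.
apply; rewrite ?lexx //= => i j; rewrite leqn0 => /eqP->.
by apply: best => //; rewrite mul0r addr0 edge_cost0_le.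
Qed.

(** The left side is a potential: k w is the capacity that w has left after the
    steps before st, and it still has to serve the edges of st at w. *)
Lemma tables_lower_bound st A (k : V -> R) :
  grows A st -> uniq A ->
  (forall w, w \notin A -> k w = (b w)%:R) ->
  (forall p, p \in st -> 0 <= x p.1 p.2) ->
  (forall p, p \in st -> ~~ y p.1 p.2 -> x p.1 p.2 = 0) ->
  (forall w, \sum_(p <- st | incident w p) x p.1 p.2 <= k w) ->
  \sum_(w <- A) interp (tables st w) (k w) <= \sum_(p <- st) step_cost p.
Proof.
elim: st A k => [|[v u] r IH] A k.
  move=> _ _ _ _ _ _; rewrite big_nil big1 // => w _.
  by rewrite /interp subrr mulr0 addr0.
move=> /= /and3P[Au vA gr] uA kA x0 yx load.
have vu : u != v by apply: contraNneq vA => <-.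
pose k' w := if (w == u) || (w == v) then k w - x v u else k w.
have x_vu : 0 <= x v u by apply: (x0 (v, u)); rewrite inE eqxx.
have rest_ge0 w : 0 <= \sum_(p <- r | incident w p) x p.1 p.2.
  rewrite big_seq_cond sumr_ge0 // => p /andP[pr _]; apply: x0.
  by rewrite inE pr orbT.
have loadr w : \sum_(p <- r | incident w p) x p.1 p.2 <= k' w.
  have := load w; rewrite /k' big_cons /incident /= [w == u]eq_sym [w == v]eq_sym orbC.
  by case: ifP => // _; rewrite lerBrDl.
have x_le w : (w == u) || (w == v) -> x v u <= k w.
  by move=> wuv; have := loadr w; rewrite /k' wuv => /(le_trans (rest_ge0 w));
    rewrite subr_ge0.
have {}IH : \sum_(w <- v :: A) interp (tables r w) (k' w) <= \sum_(p <- r) step_cost p.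
  apply: IH => //.
  - by rewrite /= vA.
  - move=> w; rewrite inE negb_or => /andP[wv wA]; rewrite /k' (negbTE wv) orbF.
    by case: eqP => [wu | _]; [rewrite wu Au in wA | apply: kA].
  - by move=> p pr; apply: x0; rewrite inE pr orbT.
  - by move=> p pr; apply: yx; rewrite inE pr orbT.
rewrite big_cons; have kv := kA v vA.
have xu : x v u <= k u by apply: x_le; rewrite eqxx.
have xv : x v u <= (b v)%:R by rewrite -kv; apply: x_le; rewrite eqxx orbT.
have step := attach_step_le (tables r) x_vu (yx (v, u) (mem_head _ _)) xu xv.
have ext := @sum_extend _ (fun w => interp (attach (tables r) v u w) (k w))
   (fun w => interp (tables r w) (k' w)) A v u uA Au vA.
rewrite -(lerD2r (interp (tables r u) (k' u) + interp (tables r v) (k' v))) ext; last first.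
  by move=> w wu wv; rewrite /k' (negbTE wu) (negbTE wv) /= /attach (negbTE wu).
rewrite [leRHS]addrAC [leLHS]addrC; apply: lerD => //.
by move: step; rewrite /k' !eqxx orbT /= -kv addrC.
Qed.
End Relaxation.

(** The integral counterpart of the potential bound, with equality for a flow x
    that attains the minimum in the table. *)
Lemma tables_backtrack v u r A (k k' : V -> nat) (x : nat) :
  uniq A -> u \in A -> v \notin A -> k v = b v ->
  split_cost (tables r) v u (k u) x = tables ((v, u) :: r) u (k u) ->
  (forall w, k' w = if (w == u) || (w == v) then (k w - x)%N else k w) ->
  \sum_(w <- A) tables ((v, u) :: r) w (k w) =
    \sum_(w <- v :: A) tables r w (k' w) + edge_cost v u x.
Proof.
move=> uA Au vA kv best_x def_k'.
have := @sum_extend _ (fun w => tables ((v, u) :: r) w (k w))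
   (fun w => tables r w (k' w)) A v u uA Au vA.
rewrite !def_k' !eqxx orbT /= -[attach _ _ _ u _]best_x /split_cost kv => ext.
apply: (addIr (tables r u (k u - x)%N + tables r v (b v - x)%N)).
rewrite ext; first by rewrite -!addrA; congr (_ + _); rewrite [RHS]addrC !addrA.
by move=> w wu wv; rewrite def_k' (negbTE wu) (negbTE wv) /= /attach (negbTE wu).
Qed.

Lemma grows_rcons A st v u :
  grows A (rcons st (v, u)) =
  [&& grows A st, u \in rev (map fst st) ++ A & v \notin rev (map fst st) ++ A].
Proof.
elim: st A => [|[v' u'] r IH] A /=; first by rewrite andbT.
by rewrite IH rev_cons cat_rcons -!andbA.
Qed.

Lemma grows_fst_notin A st p : grows A st -> p \in st -> p.1 \notin A.
Proof.
elim: st A => // -[v u] r IH A /= /and3P[_ vA gr]; rewrite inE => /orP[/eqP-> //|].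
by move=> /(IH _ gr); rewrite inE negb_or => /andP[].
Qed.

Lemma grows_mem A st p : grows A st -> p \in st ->
  (p.1 \in rev (map fst st) ++ A) && (p.2 \in rev (map fst st) ++ A).
Proof.
elim: st A => // -[v u] r IH A /= /and3P[Au _ gr]; rewrite rev_cons cat_rcons inE.
by move=> /predU1P[-> | /(IH _ gr) //]; rewrite !mem_cat mem_head inE Au !orbT.
Qed.

Lemma grows_cat A st1 st2 : grows A (st1 ++ st2) -> grows A st1.
Proof. by elim: st1 A => // -[v u] r IH A /= /and3P[-> -> /IH]. Qed.

(** The second vertex of a step is known earlier than the first. *)
Lemma grows_asym A st v u : grows A st -> (v, u) \in st -> (u, v) \notin st.
Proof.
elim: st A => // -[v' u'] r IH A /= /and3P[Au vA gr].
have last_asym i j : (i, j) = (v', u') -> (j, i) \notin (v', u') :: r.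
  move=> [-> ->]; rewrite inE negb_or; apply/andP; split.
    by apply/eqP => -[eq_uv _]; rewrite -eq_uv Au in vA.
  apply/negP => /(grows_fst_notin gr) /=.
  by rewrite inE Au orbT.
rewrite inE => /orP[/eqP/last_asym // | in_r].
rewrite inE negb_or (IH _ gr in_r) andbT; apply/eqP => /last_asym.
by rewrite inE in_r orbT.
Qed.

Lemma grows_uniq A st : uniq A -> grows A st ->
  uniq (rev (map fst st) ++ A) /\ uniq st.
Proof.
elim: st A => [|[v u] r IH] A uA //= /and3P[Au vA gr].
have uvA : uniq (v :: A) by rewrite /= vA.
have [u1 u2] := IH _ uvA gr; rewrite rev_cons cat_rcons; split=> //.
rewrite u2 andbT; apply/negP => /(grows_fst_notin gr) /=.
by rewrite mem_head.
Qed.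

End DynamicProgram.

(** * Trees *)

(** In a tree a new vertex meets the connected set of discovered vertices in
    one edge, as a second one would close a cycle. *)
Lemma tree_edge_step n (e : rel 'I_n) A st i j :
  is_tree e ->
  {in A &, forall x y, exists p, [/\ path e x p, last x p = y & {subset p <= A}]} ->
  grows A st -> {in st, forall p, e p.1 p.2} ->
  i \in rev (map fst st) ++ A -> j \in rev (map fst st) ++ A ->
  ~~ ((i \in A) && (j \in A)) -> e i j -> ((i, j) \in st) || ((j, i) \in st).
Proof.
move=> [_ e_sym e_irr _ acyclic].
elim: st A => [|[v u] r IH] A connA /=.
  by move=> _ _ -> ->.
move=> /and3P[Au vA gr] e_st; rewrite rev_cons cat_rcons => iA jA newij e_ij.
have e_vu : e v u by apply: (e_st (v, u)); rewrite mem_head.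
have connvA : {in v :: A &, forall x y,
    exists p, [/\ path e x p, last x p = y & {subset p <= v :: A}]}.
  have to_u x : x \in A -> exists p, [/\ path e x p, last x p = u & {subset p <= v :: A}].
    move=> Ax; have [p [ep lp pA]] := connA x u Ax Au.
    by exists p; split=> // w /pA; rewrite inE orbC => ->.
  have from_u y : y \in A -> exists p, [/\ path e u p, last u p = y & {subset p <= v :: A}].
    move=> Ay; have [p [ep lp pA]] := connA u y Au Ay.
    by exists p; split=> // w /pA; rewrite inE orbC => ->.
  move=> x y; rewrite !inE => /predU1P[-> | Ax] /predU1P[-> | Ay].
  - by exists [::].
  - have [p [ep lp pA]] := from_u y Ay; exists (u :: p); split=> //=; first by rewrite e_vu.
    by move=> w; rewrite inE => /predU1P[-> | /pA //]; rewrite inE Au orbT.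
  - have [p [ep lp pA]] := to_u x Ax; exists (rcons p v); split.
    + by rewrite rcons_path ep lp e_sym.
    + by rewrite last_rcons.
    + by move=> w; rewrite mem_rcons inE => /predU1P[-> | /pA //]; rewrite mem_head.
  - have [p [ep lp pA]] := connA x y Ax Ay; exists p; split=> // w /pA.
    by rewrite inE orbC => ->.
have unique_u w : w \in A -> e v w -> w = u.
  move=> Aw e_vw; apply/eqP; apply: contraT => wu.
  have [p [ep lp pA]] := connA w u Aw Au.
  case/shortenP: ep lp => p' ep' up' sub_p lp'.
  case: (acyclic [:: v, w & p']).
    by case: p' lp' {ep' up' sub_p} => //= wu'; rewrite wu' eqxx in wu.
  rewrite /ucycle /cycle /= rcons_path e_vw ep' lp' e_sym e_vu /=.
  move: up' => /= /andP[-> ->]; rewrite inE negb_or !andbT; apply/andP; split.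
    by apply: contraNneq vA => ->.
  by apply: contra vA => /sub_p/pA.
have e_r : {in r, forall p, e p.1 p.2} by move=> p pr; apply: e_st; rewrite inE pr orbT.
have [both|newij'] := boolP ((i \in v :: A) && (j \in v :: A)); last first.
  by have /orP[] := IH _ connvA gr e_r iA jA newij' e_ij; rewrite !inE => ->; rewrite !orbT.
move: both newij e_ij.
rewrite !inE => /andP[/predU1P[-> | Ai] /predU1P[-> | Aj]] newij e_ij.
- by rewrite e_irr in e_ij.
- by rewrite (unique_u j Aj e_ij) eqxx.
- by rewrite e_sym in e_ij; rewrite (unique_u i Ai e_ij) eqxx orbT.
- by rewrite Ai Aj in newij.
Qed.

Section SpanningSteps.
Variables (n : nat) (e : rel 'I_n) (r : 'I_n) (st : seq ('I_n * 'I_n)).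
Hypotheses (treeE : is_tree e) (gr : grows [:: r] st)
  (e_st : {in st, forall p, e p.1 p.2})
  (all_st : forall i, i \in rev (map fst st) ++ [:: r]).

(** Together with [grows_asym], every edge is a step in exactly one of its two
    directions. *)
Lemma tree_edge_mem i j : e i j = ((i, j) \in st) || ((j, i) \in st).
Proof.
have [_ e_sym e_irr _ _] := treeE.
apply/idP/idP => [e_ij | /orP[/e_st // | /e_st /=]]; last by rewrite e_sym.
apply: (tree_edge_step treeE _ gr e_st) => //.
  by move=> x y; rewrite !inE => /eqP-> /eqP->; exists [::].
by rewrite !inE; apply/negP => /andP[/eqP ji /eqP ij]; rewrite ij ji e_irr in e_ij.
Qed.

Let uniq_st : uniq st.
Proof. by have [] := grows_uniq (isT : uniq [:: r]) gr. Qed.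

Let swap (p : 'I_n * 'I_n) := (p.2, p.1).

Let swapK : involutive swap.
Proof. by case. Qed.

Lemma tree_sum_edges (T : nmodType) (h : 'I_n -> 'I_n -> T) :
  (forall i j, e i j -> h i j = h j i) ->
  \sum_(i < n) \sum_(j < n | (i < j)%N && e i j) h i j =
    \sum_(p <- st) h p.1 p.2.
Proof.
move=> h_sym; have [_ e_sym e_irr _ _] := treeE.
rewrite pair_big_dep /= (bigID (fun p => p \in st)) /=.
rewrite [X in _ + X](reindex_inj (inv_inj swapK)) /= [RHS]big_uniq //=.
rewrite [RHS](bigID (fun p : 'I_n * 'I_n => (p.1 < p.2)%N)) /=.
congr (_ + _).
  apply: eq_bigl => -[i j] /=; rewrite andbC.
  by case: (boolP ((i, j) \in st)) => //= /e_st /= ->; rewrite andbT.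
have mem_swap (i j : 'I_n) : ((j < i)%N && e j i && ((j, i) \notin st)) =
    ((i, j) \in st) && ~~ (i < j)%N.
  apply/idP/idP => [/andP[/andP[lt_ji e_ji] ji] | /andP[ij le_ji]].
    by move: e_ji; rewrite tree_edge_mem (negbTE ji) /= => ->; rewrite -leqNgt ltnW.
  have e_ij := e_st ij; rewrite e_sym e_ij (grows_asym gr ij) !andbT.
  rewrite ltn_neqAle leqNgt le_ji andbT.
  by apply: contraTneq e_ij => /val_inj /= ->; rewrite e_irr.
rewrite (eq_bigl (fun p => (p \in st) && ~~ (p.1 < p.2)%N)); last by case=> i j;
  apply: mem_swap.
by apply: eq_bigr => -[i j] /= /andP[/e_st /= e_ij _]; rewrite h_sym // e_sym.
Qed.

Lemma tree_sum_incident (T : nmodType) (h : 'I_n -> 'I_n -> T) (i : 'I_n) :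
  (forall i j, e i j -> h i j = h j i) ->
  \sum_(j | e i j) h i j = \sum_(p <- st | incident i p) h p.1 p.2.
Proof.
move=> h_sym; have [_ e_sym e_irr _ _] := treeE.
have e_mem a c : (a, c) \in st -> e a c by apply: (@e_st (a, c)).
have -> : \sum_(p <- st | incident i p) h p.1 p.2 =
    \sum_(p | (p \in st) && incident i p) h p.1 p.2.
  by rewrite big_mkcondr -big_uniq // -big_mkcond.
pose to_pair j := if (i, j) \in st then (i, j) else (j, i).
pose of_pair (p : 'I_n * 'I_n) := if p.1 == i then p.2 else p.1.
rewrite (reindex_onto to_pair of_pair) /= => [|[a c]]; last first.
  rewrite /incident /to_pair /of_pair /= => /andP[ac].
  case: eqP => [<- | ai /= /eqP ci]; first by rewrite ac.
  by rewrite -ci in ac *; rewrite (negbTE (grows_asym gr ac)).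
apply: eq_big => [j | j e_ij]; last first.
  by rewrite /to_pair; case: ifP => //= _; apply: h_sym.
rewrite tree_edge_mem /to_pair /of_pair /incident.
case: (boolP ((i, j) \in st)) => [ij | _] /=; first by rewrite ij !eqxx.
rewrite eqxx orbT andbT; case: (boolP ((j, i) \in st)) => //= ji.
case: (eqVneq j i) => [eq_ji | _]; last by rewrite eqxx.
by move: (e_mem _ _ ji); rewrite eq_ji e_irr.
Qed.
End SpanningSteps.

(** * Optimality *)
Lemma edge_cost_use (V : eqType) (P Q : V -> V -> int) (v u : V) (x : nat) :
  edge_cost P Q v u x = P v u * x%:Z + Q v u * ((0 < x)%N || (Q v u < 0) : nat)%:Z.
Proof.
rewrite /edge_cost; case: x => [|x] /=; last by rewrite mulr1.
by rewrite mulr0 add0r; case: ltP => [lt0 | le0] /=; rewrite ?mulr1 ?mulr0; lia.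
Qed.

Section Optimality.
Variables (R : realType) (I : instance).
Let V := 'I_(nvert I).
Variables (r : V) (st : seq (V * V)) (D : int) (P Q : V -> V -> int).
Hypotheses (treeI : tree_instance I) (gr : grows [:: r] st)
  (e_st : {in st, forall p, edge p.1 p.2})
  (all_st : forall i, i \in rev (map fst st) ++ [:: r])
  (D_gt0 : 0 < D)
  (P_scaled : forall i j : V, edge i j -> (P i j)%:~R = D%:~R * pcost i j)
  (Q_scaled : forall i j : V, edge i j -> (Q i j)%:~R = D%:~R * qcost i j).

(** The common denominator D makes all costs integral without affecting which
    solutions are optimal. *)
Lemma scaled_objective (x : V -> V -> R) (y : V -> V -> bool) :
  edge_symmetric (@edge I) x -> edge_symmetric (@edge I) y ->
  D%:~R * objective x y = \sum_(p <- st) step_cost P Q x y p.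
Proof.
move=> x_sym y_sym; have [tree p_sym q_sym] := treeI.
rewrite /objective (tree_sum_edges tree gr e_st all_st) => [|i j e_ij]; last first.
  by rewrite p_sym // q_sym // x_sym // y_sym.
rewrite mulr_sumr; apply: eq_big_seq => p /e_st e_p.
rewrite /step_cost -[(P _ _)%:~R](ratr_int R) -[(Q _ _)%:~R](ratr_int R).
by rewrite P_scaled // Q_scaled // !rmorphM /= !ratr_int; ring.
Qed.

(** The solution attains the table entry at the root, and by the potential
    argument no real solution is cheaper. *)
Lemma optimal_of_tables (x : V -> V -> nat) (y : V -> V -> bool) :
  edge_symmetric (@edge I) x -> edge_symmetric (@edge I) y ->
  {in st, forall p, y p.1 p.2 = (0 < x p.1 p.2)%N || (Q p.1 p.2 < 0)} ->
  (forall w, (\sum_(p <- st | incident w p) x p.1 p.2 <= cap w)%N) ->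
  \sum_(p <- st) edge_cost P Q p.1 p.2 (x p.1 p.2) = tables (@cap I) P Q st r (cap r) ->
  optimal (fun i j => ratr (x i j)%:R : R) y.
Proof.
move=> x_sym y_sym def_y load cost_x; have [tree p_sym q_sym] := treeI.
have [_ e_sym _ _ _] := tree.
have xR_sym : edge_symmetric (@edge I) (fun i j => ratr (x i j)%:R : R).
  by move=> i j e_ij; rewrite x_sym.
have x_le (i j : V) : edge i j -> (x i j <= cap i)%N.
  move=> e_ij; apply: leq_trans (load i).
  by rewrite -(tree_sum_incident tree gr e_st all_st) // (bigD1 j) //= leq_addr.
have x0 i j : edge i j -> ~~ y i j -> x i j = 0%N.
  have st0 p : p \in st -> ~~ y p.1 p.2 -> x p.1 p.2 = 0%N.
    by move=> /def_y ->; case: (x _ _).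
  move=> e_ij; have := e_ij.
  rewrite (tree_edge_mem tree gr e_st all_st) => /orP[/st0 // | /st0].
  by rewrite /= -x_sym // -y_sym.
split.
  split=> // [i | i j e_ij].
    under eq_bigr => j _ do rewrite ratr_nat.
    rewrite -natr_sum ler_nat; apply: leq_trans (load i).
    by rewrite (tree_sum_incident tree gr e_st all_st).
  rewrite ratr_nat ler0n /=; case y_ij: (y i j).
    rewrite mulr1 ler_nat /edge_cap leq_min x_le //= x_sym // x_le //.
    by rewrite e_sym.
  by rewrite mulr0 x0 ?y_ij.
move=> x' y' [x'_sym y'_sym load' range'].
have D_R : 0 < D%:~R :> R by rewrite ltr0z.
rewrite -(ler_pM2l D_R) !scaled_objective //.
have -> : \sum_(p <- st) step_cost P Q (fun i j => ratr (x i j)%:R : R) y p =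
    (tables (@cap I) P Q st r (cap r))%:~R.
  rewrite -cost_x rmorph_sum; apply: eq_big_seq => p p_st.
  rewrite edge_cost_use -def_y // /step_cost ratr_nat rmorphD !rmorphM /=.
  by rewrite -!pmulrn.
have := @tables_lower_bound _ (@cap I) P Q R x' y' st [:: r] (fun w => (cap w)%:R).
rewrite big_seq1 interp_nat; apply=> //.
- by move=> p /e_st /range' /andP[].
- move=> p /e_st /range'; case: (y' _ _) => //=.
  by rewrite mulr0 -eq_le eq_sym => /eqP.
move=> w; rewrite -(tree_sum_incident tree gr e_st all_st) //.
Qed.

End Optimality.

(** * Reasoning about for-programs *)

(** [Inv i] describes the state after the rounds m - 1, ..., i. *)
Lemma den_For_inv (Inv : nat -> state -> Prop) a e p s m :
  eval s e = m%:Z -> Inv m (update s a 0 m%:Z) ->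
  (forall i s', (i < m)%N -> Inv i.+1 s' -> Inv i (den p (update s' a 0 i%:Z))) ->
  Inv 0%N (den (PFor a e p) s).
Proof.
move=> /= -> /=; move: (update s a 0 m%:Z) => s0; rewrite /absz.
elim: m s0 => //= m IH s0 Inv_s step.
by apply: IH (step m s0 (ltnSn m) Inv_s) _ => i s' lt_i; apply: step; apply: ltnW.
Qed.

Lemma den_Seq p q s : den (PSeq p q) s = den q (den p s).
Proof. by []. Qed.

Lemma den_If e p q s :
  den (PIf e p q) s = if eval s e != 0 then den p s else den q s.
Proof. by []. Qed.

Lemma den_If_bool (t : bool) e p q s :
  eval s e = (t : nat)%:Z -> den (PIf e p q) s = if t then den p s else den q s.
Proof. by rewrite den_If => ->; case: t. Qed.

Definition has_input (I : instance) (s : state) : Prop :=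
  forall a k, (a < 7)%N -> s a k = input_state I a k.

Lemma has_input_update I s a k v :
  (7 <= a)%N -> has_input I s -> has_input I (update s a k v).
Proof.
move=> le_a in_s b l lt_b; rewrite /update; case: eqP => [eq_b | _] /=; last exact: in_s.
by move: lt_b; rewrite eq_b ltnNge le_a.
Qed.

Lemma update_counter s a k v b l :
  (19 < a)%N -> (b < 20)%N -> update s a k v b l = s b l.
Proof.
move=> lt_a lt_b; rewrite /update; case: eqP => // eq_b.
by move: lt_b; rewrite eq_b ltnS leqNgt lt_a.
Qed.

Definition e_n : expr := Get 0 (Cst 0).
Definition var (a : nat) : expr := Get a (Cst 0).
(** Matrices and tables have rows of length n, also the tables indexed by a
    capacity k and a vertex w. Hence no address needs a factor other than n,
    which is an input. *)
Definition pos (e1 e2 : expr) : expr := Bin Add (Bin Mul e1 e_n) e2.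
Definition cell (a : nat) (e1 e2 : expr) : expr := Get a (pos e1 e2).

Lemma nth_allpairs (S T : Type) (f : S -> T -> int) (x0 : S) (y0 : T) s t i j :
  (i < size s)%N -> (j < size t)%N ->
  nth 0 [seq f x y | x <- s, y <- t] (i * size t + j) = f (nth x0 s i) (nth y0 t j).
Proof.
elim: s i => [|x s IH] [|i] //= lt_i lt_j.
  by rewrite nth_cat size_map mul0n add0n lt_j (nth_map y0).
rewrite nth_cat size_map mulSn -addnA ltnNge leq_addr /= addKn.
exact: IH.
Qed.

Lemma edge_matrixE (I : instance) f (i j : 'I_(nvert I)) :
  load (edge_matrix f) (i * nvert I + j)%N%:Z = if edge i j then f i j else 0.
Proof.
rewrite /load /edge_matrix.
have := @nth_allpairs _ _ (fun i j => if edge i j then f i j else 0) i j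
  (enum 'I_(nvert I)) (enum 'I_(nvert I)) i j.
by rewrite !size_enum_ord !nth_ord_enum => ->.
Qed.

Lemma pos_inj n (k k' : nat) (i i' : 'I_n) :
  (k * n + i == k' * n + i')%N = (k == k') && (i == i').
Proof.
apply/eqP/andP => [eq_pos | [/eqP-> /eqP-> //]].
have n_gt0 : (0 < n)%N := leq_ltn_trans (leq0n i) (ltn_ord i).
have := congr1 (fun m => m %/ n)%N eq_pos; have := congr1 (fun m => m %% n)%N eq_pos.
rewrite /= !modnMDl !divnMDl // !modn_small // !divn_small // !addn0.
by move=> /val_inj -> ->.
Qed.

Section Input.
Variables (I : instance) (s : state).
Hypothesis in_s : has_input I s.
Implicit Types i j : 'I_(nvert I).

Lemma input_n : s 0%N 0 = (nvert I)%:Z.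
Proof. by rewrite in_s. Qed.

Lemma eval_n : eval s e_n = (nvert I)%:Z.
Proof. by rewrite /= input_n. Qed.

Lemma input_cap i : s 1%N (i : nat)%:Z = (cap i)%:Z.
Proof. by rewrite in_s //= (nth_map i) ?size_enum_ord // nth_ord_enum. Qed.

Lemma eval_pos e1 e2 (k m : nat) :
  eval s e1 = k%:Z -> eval s e2 = m%:Z -> eval s (pos e1 e2) = (k * nvert I + m)%N%:Z.
Proof. by move=> /= -> ->; rewrite input_n. Qed.

Lemma eval_cell a e1 e2 (k m : nat) :
  eval s e1 = k%:Z -> eval s e2 = m%:Z ->
  eval s (cell a e1 e2) = s a (k * nvert I + m)%N%:Z.
Proof. by move=> ek em; rewrite -(eval_pos ek em). Qed.

Lemma input_edge i j : s 2%N (i * nvert I + j)%N%:Z = (edge i j : nat)%:Z.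
Proof. by rewrite in_s //= -/(load _ _%:Z) edge_matrixE; case: edge. Qed.

Lemma input_pnum i j : edge i j -> s 3%N (i * nvert I + j)%N%:Z = numq (pcost i j).
Proof. by move=> e_ij; rewrite in_s // [LHS]edge_matrixE e_ij. Qed.

Lemma input_pden i j : edge i j -> s 4%N (i * nvert I + j)%N%:Z = denq (pcost i j).
Proof. by move=> e_ij; rewrite in_s // [LHS]edge_matrixE e_ij. Qed.

Lemma input_qnum i j : edge i j -> s 5%N (i * nvert I + j)%N%:Z = numq (qcost i j).
Proof. by move=> e_ij; rewrite in_s // [LHS]edge_matrixE e_ij. Qed.

Lemma input_qden i j : edge i j -> s 6%N (i * nvert I + j)%N%:Z = denq (qcost i j).
Proof. by move=> e_ij; rewrite in_s // [LHS]edge_matrixE e_ij. Qed.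

End Input.

(** * Discovering the tree *)

(** Array 10 marks the vertices found, arrays 11 and 12 list the second and first
    vertices of the steps found so far, and array 13 counts them. *)
Definition discover_edge : prog :=
  PIf (Get 10 (var 21))
    (PIf (cell 2 (var 21) (var 22))
      (PIf (Get 10 (var 22)) PSkip
        (PSeq (PSet 10 (var 22) (Cst 1))
        (PSeq (PSet 11 (var 13) (var 21))
        (PSeq (PSet 12 (var 13) (var 22))
              (PSet 13 (Cst 0) (Bin Add (var 13) (Cst 1)))))))
      PSkip)
    PSkip.

Definition discover_from : prog := PFor 22 e_n discover_edge.
Definition discover_pass : prog := PFor 21 e_n discover_from.
Definition discover : prog :=
  PSeq (PSet 10 (Cst 0) (Cst 1)) (PFor 20 e_n discover_pass).

Lemma path_leaves (T : eqType) (e : rel T) (C : pred T) x p :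
  path e x p -> C x -> ~~ C (last x p) ->
  exists a b, [/\ C a, ~~ C b & e a b].
Proof.
elim: p x => [|y p IH] x /=; first by move=> _ ->.
move=> /andP[e_xy ep] Cx; case: (boolP (C y)) => [Cy | nCy _]; first exact: IH.
by exists x, y.
Qed.

Section Discovery.
Variables (I : instance) (r : 'I_(nvert I)).
Let n := nvert I.
Let V := 'I_(nvert I).
Hypotheses (treeI : tree_instance I) (r0 : r = 0%N :> nat).

(** The root and the first vertices of the steps, the latest first. *)
Definition found (st : seq (V * V)) : seq V := rev (map fst st) ++ [:: r].

Definition holds_steps (st : seq (V * V)) (s : state) : Prop :=
  [/\ s 13%N 0 = (size st)%:Z,
      forall t, (t < size st)%N -> s 12%N t%:Z = ((nth (r, r) st t).1 : nat)%:Z,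
      forall t, (t < size st)%N -> s 11%N t%:Z = ((nth (r, r) st t).2 : nat)%:Z
    & grows [:: r] st /\ {in st, forall p, edge p.1 p.2}].

Definition holds_search (st : seq (V * V)) (s : state) : Prop :=
  holds_steps st s /\ forall j : V, s 10%N (j : nat)%:Z = ((j \in found st) : nat)%:Z.

(** C holds the vertices known when the pass began, and done relates the ordered
    pairs visited by the pass; vertices found during the pass need not be
    searched by it. *)
Definition searched (C : seq V) (done : rel V) (s : state) : Prop :=
  exists st, [/\ has_input I s, holds_search st s, {subset C <= found st}
    & forall a c, done a c -> a \in C -> edge a c -> c \in found st].

Lemma discover_edge_search C (done : rel V) s (i j : V) :
  searched C done s -> s 21%N 0 = (i : nat)%:Z -> s 22%N 0 = (j : nat)%:Z ->
  searched C (fun a c => done a c || ((a == i) && (c == j))) (den discover_edge s).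
Proof.
move=> [st [in_s [st_s s_vis] subC done_s]] si sj.
have same : (i \in found st -> edge i j -> j \in found st) ->
    searched C (fun a c => done a c || ((a == i) && (c == j))) s.
  move=> ok; exists st; split=> // a c /orP[/done_s // | /andP[/eqP-> /eqP->]].
  by move=> /subC; apply: ok.
rewrite /discover_edge /=; rewrite si sj s_vis (input_n in_s).
case: (boolP (i \in found st)) => [Si | nSi] /=; last by apply: same => Si;
  rewrite Si in nSi.
rewrite -PoszM -PoszD (input_edge in_s).
case: (boolP (edge i j)) => [e_ij | ne_ij] /=; last by apply: same => _ e_ij;
  rewrite e_ij in ne_ij.
rewrite s_vis; case: (boolP (j \in found st)) => [Sj | nSj] /=; first exact: same.
have [s_cnt s_v s_u [gr e_st]] := st_s.
have [[_ e_sym _ _ _] _ _] := treeI.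
have found_rcons w : (w \in found (rcons st (j, i))) = (w == j) || (w \in found st).
  by rewrite /found map_rcons rev_rcons inE.
exists (rcons st (j, i)); split.
- by do 4!(apply: has_input_update => //).
- split; last first.
    by move=> k; rewrite /update /= found_rcons s_vis eqz_nat (inj_eq val_inj); case: eqP.
  split; rewrite /update /= ?size_rcons ?s_cnt ?si ?sj //.
  + by lia.
  + move=> t; rewrite ltnS leq_eqVlt eqz_nat nth_rcons.
    by case: (ltngtP t (size st)) => //= lt_t _; apply: s_v.
  + move=> t; rewrite ltnS leq_eqVlt eqz_nat nth_rcons.
    by case: (ltngtP t (size st)) => //= lt_t _; apply: s_u.
  + split; first by rewrite grows_rcons gr Si nSj.
    move=> p; rewrite mem_rcons inE => /predU1P[-> /= | /e_st //].
    by rewrite e_sym.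
- by move=> w /subC; rewrite found_rcons orbC => ->.
move=> a c /orP[/done_s dn | /andP[_ /eqP->] _ _]; last by rewrite found_rcons eqxx.
by move=> Ca e_ac; rewrite found_rcons orbC dn.
Qed.

Lemma searched_sub C (done done' : rel V) s :
  (forall a c, done' a c -> done a c) -> searched C done s -> searched C done' s.
Proof.
move=> sub [st [in_s st_s subC done_s]]; exists st; split=> // a c /sub.
exact: done_s.
Qed.

Lemma searched_counter C done s a k v :
  (19 < a)%N -> searched C done s -> searched C done (update s a k v).
Proof.
move=> lt_a [st [in_s [[s_cnt s_v s_u st_ok] s_vis] subC done_s]].
exists st; split=> //; first by apply: has_input_update => //; apply: leq_trans lt_a.
split; last by move=> j; rewrite update_counter.
by split; rewrite ?update_counter // => t lt_t; rewrite update_counter ?s_v ?s_u.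
Qed.

Lemma discover_from_search C (done : rel V) s (i : V) :
  searched C done s -> s 21%N 0 = (i : nat)%:Z ->
  searched C (fun a c => done a c || (a == i)) (den discover_from s).
Proof.
move=> sr si; have [st [in_s _ _ _]] := sr.
pose Inv j s := searched C (fun a c => done a c || ((a == i) && (j <= c)%N)) s
  /\ s 21%N 0 = (i : nat)%:Z.
suff [inv _] : Inv 0%N (den discover_from s).
  by apply: searched_sub inv => a c; rewrite andbT.
apply: (den_For_inv (m := n) (eval_n in_s)).
  split=> //; apply: searched_counter => //; apply: searched_sub sr => a c.
  by rewrite leqNgt ltn_ord andbF orbF.
move=> j s' lt_j [inv s'i]; split; last by rewrite den_frame.
have := discover_edge_search (searched_counter (a := 22) 0 j%:Z isT inv) (i := i)
  (j := Ordinal lt_j) s'i erefl.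
apply: searched_sub => a c /orP[-> // | /andP[->]].
by rewrite leq_eqVlt -(inj_eq val_inj) eq_sym => /orP[-> | ->]; rewrite ?orbT.
Qed.

Lemma discover_pass_search C s :
  searched C (fun _ _ => false) s -> searched C (fun _ _ => true) (den discover_pass s).
Proof.
move=> sr; have [st [in_s _ _ _]] := sr.
pose Inv i s := searched C (fun a _ => (i <= a)%N) s.
suff inv : Inv 0%N (den discover_pass s) by apply: searched_sub inv.
apply: (den_For_inv (m := n) (eval_n in_s)).
  apply: searched_counter => //; apply: searched_sub sr => a c.
  by rewrite leqNgt ltn_ord.
move=> i s' lt_i inv.
have := discover_from_search (searched_counter (a := 21) 0 i%:Z isT inv)
  (i := Ordinal lt_i) erefl.
by apply: searched_sub => a c; rewrite leq_eqVlt orbC -(inj_eq val_inj) eq_sym.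
Qed.

Lemma found_size st : size (found st) = (size st).+1.
Proof. by rewrite /found size_cat size_rev size_map addn1. Qed.

(** As long as a vertex is missing, an edge leaves the set of found vertices by
    connectedness, and one pass crosses it. Hence n passes suffice. *)
Lemma discover_search (s : state) :
  (forall a k, s a k = input_state I a k) ->
  exists st, [/\ has_input I (den discover s), holds_steps st (den discover s),
    forall i, i \in found st & (size st < n)%N].
Proof.
move=> s_in.
have [[_ _ _ conn _] _ _] := treeI.
pose full st := forall i : V, i \in found st.
pose Inv m s := exists st, [/\ has_input I s, holds_search st s &
  (n <= size st + m)%N \/ full st].
have size_lt st s' : holds_search st s' -> (size st < n)%N.
  move=> [[_ _ _ [gr _]] _]; have [u _] := grows_uniq (isT : uniq [:: r]) gr.
  by rewrite -(found_size st) -(card_uniqP u) -[n in (_ <= n)%N]card_ord max_card.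
suff [st [in_s st_s [le_n | full_st]]] : Inv 0%N (den discover s).
- by have := size_lt _ _ st_s; rewrite ltnNge -[size st]addn0 le_n.
- by exists st; split=> //; [case: st_s | apply: size_lt st_s].
have in1 : has_input I (update s 10 0 1) by apply: has_input_update.
rewrite -[den discover s]/(den (PFor 20 e_n discover_pass) (update s 10 0 1)).
apply: (den_For_inv (m := n) (eval_n in1)).
  exists [::]; split; first by do 2!(apply: has_input_update => //).
    split; last first.
      move=> j; have -> : (j \in found [::]) = (j == 0%N :> nat).
        by rewrite /found /= inE -val_eqE /= r0.
      by rewrite /update /= s_in eqz_nat; case: eqP.
    by split=> //; rewrite /update /= s_in.
  by left.
move=> m s' lt_m [st [in_s' st_s' progress]].
have sr : searched (found st) (fun _ _ => false) (update s' 20 0 m%:Z).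
  by apply: searched_counter => //; exists st; split.
have [st' [in2 st2 sub2 done2]] := discover_pass_search sr.
exists st'; split=> //.
case: progress => [le_n | full_st]; last by right=> i; apply/sub2/full_st.
have [/forallP full_st | /forallPn[j nSj]] := boolP [forall i, i \in found st].
  by right=> i; apply/sub2/full_st.
left; have /connectP[p ep last_p] := conn r j.
have Sr : r \in found st by rewrite mem_cat mem_head orbT.
have nSlast : last r p \notin found st by rewrite -last_p.
have [a [c [Sa nSc e_ac]]] := path_leaves ep Sr nSlast.
have [[_ _ _ [gr _]] _] := st_s'; have [u _] := grows_uniq (isT : uniq [:: r]) gr.
have lt_size : (size (found st) < size (found st'))%N.
  apply: (@uniq_leq_size _ (c :: found st)); first by rewrite /= nSc.
  by move=> w; rewrite inE => /predU1P[-> | /sub2 //]; apply: done2 e_ac.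
by apply: leq_trans le_n _; rewrite addnS -addSn leq_add2r -ltnS -!found_size.
Qed.

End Discovery.

(** * Clearing denominators *)

(** Arrays 14 and 15 collect the scaled costs p and q of the edge (var 20,
    var 21), while the counters 22 and 23 run over all pairs. There is no
    division, so the denominator of p is left out of the factors of p when the
    two edges coincide, and likewise for q. *)
Definition scale_by (a src : nat) : prog :=
  PSet a (pos (var 20) (var 21))
    (Bin Mul (cell a (var 20) (var 21)) (cell src (var 22) (var 23))).

Definition scale_other : prog := PSeq (scale_by 14 4) (scale_by 15 6).

Definition scale_round : prog :=
  PIf (cell 2 (var 22) (var 23))
    (PSeq (PSeq (scale_by 14 6) (scale_by 15 4))
      (PIf (Bin Defs.Sub (var 20) (var 22)) scale_other
        (PIf (Bin Defs.Sub (var 21) (var 23)) scale_other PSkip)))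
    PSkip.

Definition scale_init : prog :=
  PSeq (PSet 14 (pos (var 20) (var 21)) (cell 3 (var 20) (var 21)))
       (PSet 15 (pos (var 20) (var 21)) (cell 5 (var 20) (var 21))).

Definition scale_entry : prog :=
  PIf (cell 2 (var 20) (var 21))
    (PSeq scale_init (PFor 22 e_n (PFor 23 e_n scale_round)))
    PSkip.

Definition scale : prog := PFor 20 e_n (PFor 21 e_n scale_entry).

Arguments den : simpl never.

Section Scaling.
Variable I : instance.
Let n := nvert I.
Let V := 'I_(nvert I).
Implicit Types (i j a c : V).

Definition den_at i j : int :=
  if edge i j then denq (pcost i j) * denq (qcost i j) else 1.

Definition common_den : int := \prod_(p : V * V) den_at p.1 p.2.

Lemma common_den_gt0 : 0 < common_den.
Proof.
apply: prodr_gt0 => -[i j] _; rewrite /den_at /=.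
by case: ifP => // _; rewrite mulr_gt0 ?denq_gt0.
Qed.

(** As long as the edge (i, j) itself has not been visited, the value lacks the
    division by its own denominator; visiting it restores the balance, because
    the factor for that edge is omitted. *)
Definition partially_scaled i j (done : rel V) (s : state) : Prop :=
  let D : rat := (\prod_(p : V * V | done p.1 p.2) den_at p.1 p.2)%:~R in
  let k := (i * n + j)%N%:Z in
  [/\ has_input I s, s 20%N 0 = (i : nat)%:Z, s 21%N 0 = (j : nat)%:Z,
      (s 14%N k)%:~R = pcost i j * D * (if done i j then 1 else (denq (pcost i j))%:~R)
    & (s 15%N k)%:~R = qcost i j * D * (if done i j then 1 else (denq (qcost i j))%:~R)].

Definition same_elsewhere (k : int) (s0 s : state) : Prop :=
  forall l, l != k -> s 14%N l = s0 14%N l /\ s 15%N l = s0 15%N l.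

Lemma scale_byE s (x y : nat) i j c d :
  has_input I s -> s 20%N 0 = (i : nat)%:Z -> s 21%N 0 = (j : nat)%:Z ->
  s 22%N 0 = (c : nat)%:Z -> s 23%N 0 = (d : nat)%:Z ->
  den (scale_by x y) s =
  update s x (i * n + j)%N%:Z (s x (i * n + j)%N%:Z * s y (c * n + d)%N%:Z).
Proof.
by move=> in_s si sj sc sd; rewrite /den /= si sj sc sd (input_n in_s) -!PoszM -!PoszD.
Qed.

Definition multiplied (k f g : int) (s s' : state) : Prop :=
  [/\ has_input I s', forall b, (19 < b)%N -> s' b 0 = s b 0,
      s' 14%N k = s 14%N k * f, s' 15%N k = s 15%N k * g & same_elsewhere k s s'].

Lemma scale_pair s x y i j a c :
  has_input I s -> s 20%N 0 = (i : nat)%:Z -> s 21%N 0 = (j : nat)%:Z ->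
  s 22%N 0 = (a : nat)%:Z -> s 23%N 0 = (c : nat)%:Z -> (x < 7)%N -> (y < 7)%N ->
  multiplied (i * n + j)%N%:Z (s x (a * n + c)%N%:Z) (s y (a * n + c)%N%:Z) s
    (den (PSeq (scale_by 14 x) (scale_by 15 y)) s).
Proof.
move=> in_s si sj sa sc lt_x lt_y.
have in_s1 v : has_input I (update s 14 (i * n + j)%N%:Z v) by apply: has_input_update.
rewrite den_Seq (scale_byE _ _ in_s si sj sa sc) (scale_byE _ _ (in_s1 _) si sj sa sc).
have y15 : (y == 15)%N = false by apply/eqP => y15; rewrite y15 in lt_y.
have y14 : (y == 14)%N = false by apply/eqP => y14; rewrite y14 in lt_y.
split.
- by apply: has_input_update.
- by move=> [|[|[|[|[|[|[|[|[|[|[|[|[|[|[|[|b]]]]]]]]]]]]]]]].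
- by rewrite /update /= eqxx.
- by rewrite /update /= y14 eqxx.
- by move=> l /negbTE l_k; rewrite /update /= l_k.
Qed.

Lemma scale_round_step i j a c (done : rel V) s0 s :
  partially_scaled i j done s -> same_elsewhere (i * n + j)%N%:Z s0 s ->
  edge i j -> ~~ done a c -> s 22%N 0 = (a : nat)%:Z -> s 23%N 0 = (c : nat)%:Z ->
  partially_scaled i j (fun u v => done u v || ((u == a) && (v == c)))
    (den scale_round s) /\
  same_elsewhere (i * n + j)%N%:Z s0 (den scale_round s).
Proof.
move=> [in_s si sj sp sq] same e_ij not_done sa sc.
set done' := (fun u v => _).
have D' : \prod_(p : V * V | done' p.1 p.2) den_at p.1 p.2 =
    den_at a c * \prod_(p : V * V | done p.1 p.2) den_at p.1 p.2.
  rewrite (bigD1 (a, c)) /= /done' ?eqxx ?orbT //; congr (_ * _).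
  apply: eq_bigl => -[u v] /=; rewrite xpair_eqE.
  case: (boolP ((u == a) && (v == c))) => [/andP[/eqP-> /eqP->] | _];
    last by rewrite orbF andbT.
  by rewrite (negbTE not_done).
rewrite /partially_scaled D' rmorphM /= /done'.
set D := (\prod_(p | done p.1 p.2) _)%:~R in sp sq *.
have test : eval s (cell 2 (var 22) (var 23)) = (edge a c : nat)%:Z.
  by rewrite (eval_cell (e1 := var 22) (e2 := var 23) in_s 2 sa sc) (input_edge in_s).
rewrite /scale_round (den_If_bool _ _ test); case: (boolP (edge a c)) => [e_ac | ne_ac];
  last first.
  have ij_ac : (i == a) && (j == c) = false.
    by apply/negP => /andP[/eqP ia /eqP jc]; rewrite -ia -jc e_ij in ne_ac.
  by rewrite /den_at (negbTE ne_ac) ij_ac orbF mul1r.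
rewrite den_Seq.
have := scale_pair in_s si sj sa sc (isT : (6 < 7)%N) (isT : (4 < 7)%N).
rewrite (input_qden in_s e_ac) (input_pden in_s e_ac).
move: (den (PSeq (scale_by 14 6) (scale_by 15 4)) s) => s1 [in1 ctr1 p1 q1 else1].
have same1 : same_elsewhere (i * n + j)%N%:Z s0 s1.
  by move=> l l_k; have [-> ->] := else1 l l_k; apply: same.
have [si1 sj1 sa1 sc1] : [/\ s1 20%N 0 = (i : nat)%:Z, s1 21%N 0 = (j : nat)%:Z,
    s1 22%N 0 = (a : nat)%:Z & s1 23%N 0 = (c : nat)%:Z] by rewrite !ctr1.
have branch : den (PIf (Bin Defs.Sub (var 20) (var 22)) scale_other
      (PIf (Bin Defs.Sub (var 21) (var 23)) scale_other PSkip)) s1 =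
    if (i == a) && (j == c) then s1 else den scale_other s1.
  rewrite !den_If [eval _ _]/= [in X in if _ then _ else X]/= si1 sj1 sa1 sc1 !subr_eq0.
  by rewrite !eqz_nat -!(inj_eq val_inj); case: eqP => //=; case: eqP.
rewrite branch /den_at e_ac;
  case: (boolP ((i == a) && (j == c))) => [/andP[/eqP ia /eqP jc] | ij_ac].
  subst a c; rewrite (negbTE not_done) in sp sq; rewrite orbT.
  by split=> //; split=> //; rewrite ?p1 ?q1 ?rmorphM /= ?sp ?sq; ring.
have := scale_pair in1 si1 sj1 sa1 sc1 (isT : (4 < 7)%N) (isT : (6 < 7)%N).
rewrite (input_qden in1 e_ac) (input_pden in1 e_ac) -/scale_other.
move: (den scale_other s1) => s2 [in2 ctr2 p2 q2 else2].
split; last by move=> l l_k; have [-> ->] := else2 l l_k; apply: same1.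
by split=> //; rewrite ?ctr2 // ?p2 ?q2 ?p1 ?q1 !rmorphM /= ?sp ?sq ?(negbTE ij_ac)
  ?orbF; case: (done i j); ring.
Qed.

Definition scaled i j (s : state) : Prop :=
  (s 14%N (i * n + j)%N%:Z)%:~R = common_den%:~R * pcost i j /\
  (s 15%N (i * n + j)%N%:Z)%:~R = common_den%:~R * qcost i j.

Lemma partially_scaled_counter i j done s (b : nat) k v :
  (21 < b)%N -> partially_scaled i j done s -> partially_scaled i j done (update s b k v).
Proof.
move=> lt_b [in_s si sj sp sq].
have ne b' : (b' < 22)%N -> update s b k v b' =1 s b'.
  move=> lt_b' l; rewrite /update; case: eqP => // eq_b.
  by move: lt_b'; rewrite eq_b ltnS leqNgt lt_b.
split; rewrite ?ne //; apply: has_input_update => //; exact: leq_trans lt_b.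
Qed.

Lemma partially_scaled_ext i j done done' s :
  done =2 done' -> partially_scaled i j done s -> partially_scaled i j done' s.
Proof.
move=> eq_done [in_s si sj sp sq]; split; rewrite // ?sp ?sq eq_done;
  by rewrite (eq_bigl (fun p => done' p.1 p.2)) // => p; rewrite eq_done.
Qed.

Lemma scale_entry_scaled i j s :
  has_input I s -> s 20%N 0 = (i : nat)%:Z -> s 21%N 0 = (j : nat)%:Z ->
  [/\ has_input I (den scale_entry s), edge i j -> scaled i j (den scale_entry s)
    & same_elsewhere (i * n + j)%N%:Z s (den scale_entry s)].
Proof.
move=> in_s si sj.
have test : eval s (cell 2 (var 20) (var 21)) = (edge i j : nat)%:Z.
  by rewrite (eval_cell (e1 := var 20) (e2 := var 21) in_s 2 si sj) (input_edge in_s).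
rewrite /scale_entry (den_If_bool _ _ test); case: (boolP (edge i j)) => [e_ij | _];
  last by split.
rewrite den_Seq; set s1 := den scale_init s.
have def_s1 : s1 = update (update s 14 (i * n + j)%N%:Z (numq (pcost i j)))
    15 (i * n + j)%N%:Z (numq (qcost i j)).
  have set_entry s' x y : has_input I s' -> s' 20%N 0 = (i : nat)%:Z ->
      s' 21%N 0 = (j : nat)%:Z ->
      den (PSet x (pos (var 20) (var 21)) (cell y (var 20) (var 21))) s' =
      update s' x (i * n + j)%N%:Z (s' y (i * n + j)%N%:Z).
    by move=> in_s' si' sj'; rewrite /den /= si' sj' (input_n in_s') -PoszM -PoszD.
  rewrite /s1 den_Seq (set_entry s 14 3)%N // (input_pnum in_s e_ij) set_entry //.
    by rewrite -[update _ 14 _ _ 5%N _]/(s 5%N _) (input_qnum in_s e_ij).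
  exact: has_input_update.
have num_den (p : rat) : (numq p)%:~R = p * 1%:~R * (denq p)%:~R.
  by rewrite mulr1 -{2}[p]divq_num_den divfK // intr_eq0 denq_neq0.
have start : partially_scaled i j (fun _ _ => false) s1.
  rewrite /partially_scaled def_s1 big_pred0 //.
  by split; rewrite /update /= ?eqxx -?num_den //; do 2!(apply: has_input_update => //).
have same1 : same_elsewhere (i * n + j)%N%:Z s s1.
  by rewrite def_s1 => l /negbTE l_k; rewrite /update /= l_k.
have in1 : has_input I s1 by case: start.
pose Row (a : nat) s' := partially_scaled i j (fun u _ => (a <= u)%N) s' /\
  same_elsewhere (i * n + j)%N%:Z s s'.
suff [[in2 _ _ p2 q2] same2] : Row 0%N (den (PFor 22 e_n (PFor 23 e_n scale_round)) s1).
  by split=> // _; split; rewrite ?p2 ?q2 mulr1 mulrC.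
apply: (den_For_inv (m := n) (eval_n in1)).
  split; last exact: same1.
  apply: partially_scaled_counter => //; apply: partially_scaled_ext start => u w.
  by rewrite leqNgt ltn_ord.
move=> a s2 lt_a [part2 same2].
pose Col (c : nat) s' := [/\ partially_scaled i j
    (fun u w => (a < u)%N || ((u == a :> nat) && (c <= w)%N)) s',
  same_elsewhere (i * n + j)%N%:Z s s' & s' 22%N 0 = a%:Z].
suff [part3 same3 _] : Col 0%N (den (PFor 23 e_n scale_round) (update s2 22 0 a%:Z)).
  split=> //; apply: partially_scaled_ext part3 => u w.
  by rewrite andbT [RHS]leq_eqVlt orbC eq_sym.
have in2 : has_input I (update s2 22 0 a%:Z).
  by apply: has_input_update => //; case: part2.
apply: (den_For_inv (m := n) (eval_n in2)).
  split=> //; do 2!(apply: partially_scaled_counter => //).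
  apply: partially_scaled_ext part2 => u w.
  by rewrite [(n <= w)%N]leqNgt ltn_ord andbF orbF.
move=> c s3 lt_c [part3 same3 s3a].
have fresh : ~~ ((a < Ordinal lt_a)%N || ((Ordinal lt_a == a :> nat) && (c < Ordinal
  lt_c)%N)).
  by rewrite /= !ltnn andbF.
have part3' := partially_scaled_counter (b := 23) 0 c%:Z isT part3.
have [] := @scale_round_step i j (Ordinal lt_a) (Ordinal lt_c) _ s _ part3' same3 e_ij
  fresh s3a erefl.
move=> part4 same4; split=> //; last first.
  by rewrite den_frame.
apply: partially_scaled_ext part4 => u w.
rewrite -orbA -!(inj_eq val_inj) /= -andb_orr; congr (_ || (_ && _)).
by rewrite [RHS]leq_eqVlt orbC [in RHS]eq_sym.
Qed.

Lemma scale_scaled s :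
  has_input I s ->
  has_input I (den scale s) /\ forall i j, edge i j -> scaled i j (den scale s).
Proof.
move=> in_s.
pose done_ok (done : rel V) s' := has_input I s' /\
  forall i j, done i j -> edge i j -> scaled i j s'.
have done_counter done s' b k v : (19 < b)%N -> done_ok done s' -> done_ok done (update
  s' b k v).
  move=> lt_b [in_s' ok]; split; first by apply: has_input_update => //;
    apply: leq_trans lt_b.
  by move=> i j dn e_ij; rewrite /scaled !update_counter //; apply: ok.
have done_sub (done done' : rel V) s' : (forall i j, done' i j -> done i j) ->
    done_ok done s' -> done_ok done' s'.
  by move=> sub [in_s' ok]; split=> // i j /sub; apply: ok.
suff [in_s' ok] : done_ok (fun u _ => 0 <= u)%N (den scale s) by split=> // i j; apply: ok.
apply: (@den_For_inv (fun a : nat => done_ok (fun u _ => a <= u)%N) _ _ _ _ n (eval_n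
  in_s)).
  by split=> [|i j]; [apply: has_input_update | rewrite leqNgt ltn_ord].
move=> a s1 lt_a ok1; have ok1' := done_counter _ _ 20%N 0 a%:Z isT ok1.
pose Col (c : nat) s' := done_ok (fun u w => (a < u)%N || ((u == a :> nat) && (c <=
  w)%N)) s' /\
  s' 20%N 0 = a%:Z.
suff [ok2 _] : Col 0%N (den (PFor 21 e_n scale_entry) (update s1 20 0 a%:Z)).
  by apply: done_sub ok2 => u w; rewrite andbT [(a <= u)%N]leq_eqVlt orbC eq_sym.
have [in1 _] := ok1'.
apply: (den_For_inv (m := n) (eval_n in1)).
  split=> //; apply: done_counter => //; apply: done_sub ok1' => u w.
  by rewrite [(n <= w)%N]leqNgt ltn_ord andbF orbF.
move=> c s2 lt_c [ok2 s2a]; split; last by rewrite den_frame.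
have [in2 scaled2] := done_counter _ _ 21%N 0 c%:Z isT ok2.
have [in3 new same] := scale_entry_scaled (i := Ordinal lt_a) (j := Ordinal lt_c) in2
  s2a erefl.
split=> // u w dn e_uw.
have [/andP[/eqP eq_u /eqP eq_w] | ne] := boolP ((u == Ordinal lt_a) && (w == Ordinal
  lt_c)).
  by rewrite eq_u eq_w in e_uw *; apply: new.
have ne_pos : (u * n + w)%N%:Z != (Ordinal lt_a * n + Ordinal lt_c)%N%:Z.
  by rewrite eqz_nat pos_inj.
rewrite /scaled; have [-> ->] := same _ ne_pos; apply: scaled2 => //.
move: dn ne; rewrite -!(inj_eq val_inj) /=.
by case: eqP => [-> | _]; rewrite ?ltnn //= leq_eqVlt eq_sym => /orP[-> | ->].
Qed.
End Scaling.

(** * Filling the tables *)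

(** Array 16 holds the tables, array 17 the chosen flows, and array 18 the best
    cost so far (position 2) and the cost of the current candidate (position 3).
    The counters 20, 21 and 22 are the index of the step (v, u), the capacity k
    and the candidate flow. *)
Definition e_v : expr := Get 12 (var 20).
Definition e_u : expr := Get 11 (var 20).
Definition tmp (a : int) : expr := Get 18 (Cst a).

Definition candidate_cost : expr :=
  Bin Add
    (Bin Add (cell 16 (Bin Defs.Sub (var 21) (var 22)) e_u)
             (cell 16 (Bin Defs.Sub (Get 1 e_v) (var 22)) e_v))
    (Bin Add (Bin Mul (var 22) (cell 14 e_v e_u)) (cell 15 e_v e_u)).

Definition try_candidate : prog :=
  PIf (var 22)
    (PIf (Bin Leq (var 22) (var 21))
      (PSeq (PSet 18 (Cst 3) candidate_cost)
        (PIf (Bin Leq (tmp 2) (tmp 3)) PSkip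
          (PSeq (PSet 18 (Cst 2) (tmp 3)) (PSet 17 (pos (var 21) e_v) (var 22)))))
      PSkip)
    PSkip.

Definition try_zero : prog :=
  PSeq (PSet 17 (pos (var 21) e_v) (Cst 0))
  (PSeq (PSet 18 (Cst 2) (Bin Add (cell 16 (var 21) e_u) (cell 16 (Get 1 e_v) e_v)))
    (PIf (Bin Leq (Cst 0) (cell 15 e_v e_u)) PSkip
      (PSet 18 (Cst 2) (Bin Add (tmp 2) (cell 15 e_v e_u))))).

Definition fill_entry : prog :=
  PSeq try_zero
  (PSeq (PFor 22 (Bin Add (Get 1 e_v) (Cst 1)) try_candidate)
        (PSet 16 (pos (var 21) e_u) (tmp 2))).

Definition fill_step : prog :=
  PIf (Bin Leq (Bin Add (var 20) (Cst 1)) (var 13))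
    (PFor 21 (Bin Add (Get 1 e_u) (Cst 1)) fill_entry)
    PSkip.

Definition fill : prog := PFor 20 e_n fill_step.

Lemma eval_bin s o e1 e2 : eval s (Bin o e1 e2) = eval_op o (eval s e1) (eval s e2).
Proof. by []. Qed.

Lemma eval_lt s e1 e2 (x y : nat) :
  eval s e1 = x%:Z -> eval s e2 = y%:Z ->
  eval s (Bin Leq (Bin Add e1 (Cst 1)) e2) = ((x < y)%N : nat)%:Z.
Proof.
rewrite !eval_bin => -> -> /=; congr ((nat_of_bool _)%:Z); rewrite -lez_nat.
by congr (_ <= _); rewrite /=; lia.
Qed.

Lemma den_Set s a e1 e2 k v :
  eval s e1 = k -> eval s e2 = v -> den (PSet a e1 e2) s = update s a k v.
Proof. by rewrite /den => -> ->. Qed.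

Section Tables.
Variables (I : instance) (r : 'I_(nvert I)).
Let n := nvert I.
Let V := 'I_(nvert I).
Variables (st : seq (V * V)) (P Q : V -> V -> int).
Hypothesis treeI : tree_instance I.
Implicit Types (w v u : V) (s : state) (F : V -> nat -> int).

Definition ready s : Prop :=
  [/\ has_input I s, holds_steps r st s,
      forall i j : V, s 14%N (i * n + j)%N%:Z = P i j
    & forall i j : V, s 15%N (i * n + j)%N%:Z = Q i j].

(** The arrays that hold the input, the result of the search and the scaled
    costs. *)
Definition needed (a : nat) : bool := (a < 7)%N || (9 < a < 16)%N.

Lemma ready_ext s s' : (forall a k, needed a -> s' a k = s a k) -> ready s -> ready s'.
Proof.
move=> eq_s [in_s [s_cnt s_v s_u st_ok] sP sQ]; split.
- by move=> a k lt_a; rewrite eq_s ?in_s // /needed lt_a.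
- by split; rewrite ?eq_s // => t lt_t; rewrite eq_s ?s_v ?s_u.
- by move=> i j; rewrite eq_s.
- by move=> i j; rewrite eq_s.
Qed.

Lemma ready_update s a k z : ~~ needed a -> ready s -> ready (update s a k z).
Proof.
move=> free; apply: ready_ext => b l nb; rewrite /update.
by case: eqP => // eq_b; rewrite -eq_b nb in free.
Qed.

Lemma ready_den p s : all (fun a => ~~ needed a) (writes p) -> ready s -> ready (den p s).
Proof.
move=> /allP free; apply: ready_ext => a k na; apply: den_frame.
by apply: contraL na => /free.
Qed.

(** The row of u is replaced in place, from the largest capacity downwards: the
    new entry at k depends on old entries at positions up to k only, and those
    from m on are new. *)
Definition holds_mixed F (v u : V) (m : nat) s : Prop :=
  forall w k, (k <= cap w)%N -> s 16%N (k * n + w)%N%:Z =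
    if (w == u) && (m <= k)%N then attach (@cap I) P Q F v u u k else F w k.

Section Step.
Variables (t : nat) (F : V -> nat -> int).
Hypothesis lt_t : (t < size st)%N.
Let v := (nth (r, r) st t).1.
Let u := (nth (r, r) st t).2.

Lemma eval_v s : ready s -> s 20%N 0 = t%:Z -> eval s e_v = (v : nat)%:Z.
Proof. by move=> [_ [_ s_v _ _] _ _] /= ->; apply: s_v. Qed.

Lemma eval_u s : ready s -> s 20%N 0 = t%:Z -> eval s e_u = (u : nat)%:Z.
Proof. by move=> [_ [_ _ s_u _] _ _] /= ->; apply: s_u. Qed.

Lemma eval_cap_v s : ready s -> s 20%N 0 = t%:Z -> eval s (Get 1 e_v) = (cap v)%:Z.
Proof. by move=> rs st20; rewrite -[LHS]/(s 1%N (eval s e_v)) eval_v //;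
  case: rs => in_s _ _ _; apply: input_cap. Qed.

Lemma eval_cap_u s : ready s -> s 20%N 0 = t%:Z -> eval s (Get 1 e_u) = (cap u)%:Z.
Proof. by move=> rs st20; rewrite -[LHS]/(s 1%N (eval s e_u)) eval_u //;
  case: rs => in_s _ _ _; apply: input_cap. Qed.

Lemma step_neq s : ready s -> v != u.
Proof.
move=> [_ [_ _ _ [_ e_st]] _ _]; have [[_ _ e_irr _ _] _ _] := treeI.
have := e_st _ (mem_nth (r, r) lt_t); rewrite -/v -/u.
by apply: contraTneq => ->; rewrite e_irr.
Qed.

Definition cost_of (k x : nat) : int := split_cost (@cap I) P Q F v u k x.

(** The candidate 0 comes first, because its cost has another form, and the
    others follow from the largest downwards. Array 17 changes only in the
    entry for k and v. *)
Definition best_so_far (k x : nat) (s0 s : state) : Prop :=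
  [/\ ready s, s 20%N 0 = t%:Z, s 21%N 0 = k%:Z,
      holds_mixed F v u k.+1 s
    & [/\ forall l, l != (k * n + v)%N%:Z -> s 17%N l = s0 17%N l,
      (exists c : nat, [/\ s 17%N (k * n + v)%N%:Z = c%:Z, (c <= k)%N, (c <= cap v)%N
        & s 18%N 2 = cost_of k c])
    & forall x', (x' <= k)%N -> (x' <= cap v)%N -> (x' == 0%N) || (x <= x')%N ->
        s 18%N 2 <= cost_of k x']].

Lemma try_zero_best k s :
  (k <= cap u)%N ->
  ready s -> s 20%N 0 = t%:Z -> s 21%N 0 = k%:Z -> holds_mixed F v u k.+1 s ->
  best_so_far k (cap v).+1 s (den try_zero s).
Proof.
move=> le_k rs s20 s21 mix; have in_s : has_input I s by case: rs.
have uv : v == u = false by apply: negbTE (step_neq rs).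
have eq_den : den try_zero s =
    let s1 := update s 17 (k * n + v)%N%:Z 0 in
    let s2 := update s1 18 2 (F u k + F v (cap v)) in
    if 0 <= Q v u then s2 else update s2 18 2 (F u k + F v (cap v) + Q v u).
  rewrite /try_zero den_Seq.
  rewrite (den_Set _ (eval_pos in_s (e1 := var 21) s21 (eval_v rs s20)) erefl).
  set s1 := update s _ _ _; have r1 : ready s1 by rewrite /s1; apply: ready_update.
  have in1 : has_input I s1 by case: r1.
  have v1 := eval_v r1 s20; have u1 := eval_u r1 s20.
  have base : eval s1 (Bin Add (cell 16 (var 21) e_u) (cell 16 (Get 1 e_v) e_v)) =
      F u k + F v (cap v).
    rewrite eval_bin (eval_cell (e1 := var 21) in1 _ s21 u1).
    rewrite (eval_cell in1 _ (eval_cap_v r1 s20) v1).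
    by rewrite -![s1 16%N _]/(s 16%N _) !mix // uv /= ltnn andbF.
  rewrite den_Seq (den_Set _ erefl base).
  set s2 := update s1 18 _ _; have r2 : ready s2 by rewrite /s2; apply: ready_update.
  have in2 : has_input I s2 by case: r2.
  have q2 : eval s2 (cell 15 e_v e_u) = Q v u.
    by rewrite (eval_cell in2 _ (eval_v r2 s20) (eval_u r2 s20)); case: r2 => _ _ _ ->.
  have test : eval s2 (Bin Leq (Cst 0) (cell 15 e_v e_u)) = ((0 <= Q v u)%R : nat)%:Z.
    by rewrite eval_bin q2.
  rewrite (den_If_bool _ _ test) /=; case: ifP => // _.
  by apply: den_Set; rewrite // eval_bin q2 /= /s2 /update /= ?eqxx.
have best0 : F u k + F v (cap v) + Num.min 0 (Q v u) = cost_of k 0.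
  by rewrite /cost_of /split_cost !subn0 /edge_cost eqxx.
set s' := den _ s.
have s'17 l : s' 17%N l = if l == (k * n + v)%N%:Z then 0 else s 17%N l.
  by rewrite /s' eq_den /=; case: ifP => _; rewrite /update /=.
have s'18 : s' 18%N 2 = cost_of k 0.
  rewrite /s' eq_den -best0 minEle /=.
  by case: ifP => _; rewrite /update /= ?eqxx ?addr0.
have other a l : a != 17%N -> a != 18%N -> s' a l = s a l.
  by move=> a17 a18; apply: den_frame; rewrite !inE !negb_or a17 a18.
split; [exact: ready_den | by rewrite other | by rewrite other | | split].
- by move=> w k' le_k'; rewrite other // mix.
- by move=> l /negbTE l_k; rewrite s'17 l_k.
- by exists 0%N; rewrite s'17 eqxx s'18.
move=> x' _ le_x'; rewrite [(_ < x')%N]ltnNge le_x' orbF => /eqP->.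
by rewrite s'18.
Qed.

Lemma try_candidate_best k x s0 s :
  (k <= cap u)%N -> (x <= cap v)%N -> best_so_far k x.+1 s0 s -> s 22%N 0 = x%:Z ->
  best_so_far k x s0 (den try_candidate s).
Proof.
move=> le_k le_x [rs s20 s21 mix [col [c [s17 ck cv s18]] low]] s22.
have in_s : has_input I s by case: rs.
have uv : v == u = false by apply: negbTE (step_neq rs).
have skip : (forall x', (x' <= k)%N -> (x' <= cap v)%N -> x' = x -> x != 0%N ->
    s 18%N 2 <= cost_of k x') -> best_so_far k x s0 s.
  move=> at_x; split=> //; split=> //; first by exists c.
  move=> x' xk xv; rewrite leq_eqVlt => /or3P[x0 | /eqP eq_x | lt_x].
  - by apply: low; rewrite // x0.
  - case: (eqVneq x' 0%N) => [x0 | x0]; first by apply: low; rewrite // x0.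
    by apply: at_x; rewrite // eq_x.
  - by apply: low; rewrite // lt_x orbT.
have test_x : eval s (var 22) = x%:Z by [].
rewrite /try_candidate den_If test_x; case: eqP => [[x0] | /eqP x0] /=.
  by apply: skip => x' _ _ _; rewrite x0.
rewrite eqz_nat in x0.
have test_k : eval s (Bin Leq (var 22) (var 21)) = ((x <= k)%N : nat)%:Z.
  by rewrite eval_bin [eval s _]s22 [eval s _]s21.
rewrite (den_If_bool _ _ test_k); case: leqP => [xk | kx]; last first.
  by apply: skip => x' xk _ eq_x; rewrite eq_x leqNgt kx in xk.
have val_x : eval s candidate_cost = cost_of k x.
  have vE := eval_v rs s20; have uE := eval_u rs s20.
  have kx : eval s (Bin Defs.Sub (var 21) (var 22)) = (k - x)%N%:Z.
    by rewrite eval_bin [eval s _]s21 test_x /= -subzn.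
  have bx : eval s (Bin Defs.Sub (Get 1 e_v) (var 22)) = (cap v - x)%N%:Z.
    by rewrite eval_bin (eval_cap_v rs s20) test_x /= -subzn.
  rewrite !eval_bin (eval_cell in_s _ kx uE) (eval_cell in_s _ bx vE).
  rewrite !(eval_cell in_s _ vE uE) test_x /=.
  have [_ _ -> ->] := rs.
  rewrite !mix ?uv ?(leq_trans (leq_subr _ _)) // eqxx ltnNge leq_subr /=.
  rewrite /cost_of /split_cost /edge_cost (negbTE x0).
  by rewrite [P v u * _]mulrC.
rewrite den_Seq (den_Set _ erefl val_x); set s1 := update s 18 _ _.
have r1 : ready s1 by rewrite /s1; apply: ready_update.
have in1 : has_input I s1 by case: r1.
have s1_2 : eval s1 (tmp 2) = s 18%N 2 by [].
have s1_3 : eval s1 (tmp 3) = cost_of k x by rewrite /= /s1 /update /= ?eqxx.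
have test_best : eval s1 (Bin Leq (tmp 2) (tmp 3)) = ((s 18%N 2 <= cost_of k x)%R : nat)%:Z.
  by rewrite eval_bin s1_2 s1_3.
rewrite (den_If_bool _ _ test_best); case: lerP => [le_best | lt_best].
  have [_ _ _ mix' [col' ex' low']] := skip (fun x' _ _ eq_x _ =>
    eq_ind_r (fun z => s 18%N 2 <= cost_of k z) le_best eq_x).
  by split.
have put17 : den (PSeq (PSet 18 (Cst 2) (tmp 3)) (PSet 17 (pos (var 21) e_v) (var 22))) s1 =
    update (update s1 18 2 (cost_of k x)) 17 (k * n + v)%N%:Z x%:Z.
  rewrite den_Seq (den_Set _ erefl s1_3).
  set s2 := update s1 18 _ _; have r2 : ready s2 by rewrite /s2; apply: ready_update.
  have in2 : has_input I s2 by case: r2.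
  have s2_22 : eval s2 (var 22) = x%:Z := s22.
  have s2_21 : eval s2 (var 21) = k%:Z := s21.
  by rewrite (den_Set _ (eval_pos in2 s2_21 (eval_v r2 s20)) s2_22).
rewrite put17; split=> //.
- by do 2!(apply: ready_update => //).
split.
- by move=> l l_k; rewrite /update /= (negbTE l_k); apply: col.
- by exists x; rewrite /update /= eqxx.
move=> x' xk' xv' x'_ok; rewrite /update /=.
have [-> // | ne_x] := eqVneq x' x.
apply: le_trans (ltW lt_best) _; apply: low => //.
by case/orP: x'_ok => [-> // | le_x']; rewrite ltn_neqAle [x == x']eq_sym ne_x le_x' orbT.
Qed.

Definition chosen k s : Prop :=
  exists c : nat, [/\ s 17%N (k * n + v)%N%:Z = c%:Z, (c <= k)%N, (c <= cap v)%N
    & cost_of k c = attach (@cap I) P Q F v u u k].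

Lemma fill_entry_holds k s :
  (k <= cap u)%N ->
  ready s -> s 20%N 0 = t%:Z -> s 21%N 0 = k%:Z -> holds_mixed F v u k.+1 s ->
  [/\ ready (den fill_entry s), holds_mixed F v u k (den fill_entry s),
      chosen k (den fill_entry s)
    & forall l, l != (k * n + v)%N%:Z -> den fill_entry s 17%N l = s 17%N l].
Proof.
move=> le_k rs s20 s21 mix.
have best0 := try_zero_best le_k rs s20 s21 mix.
rewrite /fill_entry den_Seq; move: (den try_zero s) best0 => s1 best0.
rewrite den_Seq.
have best1 : best_so_far k 0 s (den (PFor 22 (Bin Add (Get 1 e_v) (Cst 1))
  try_candidate) s1).
  have [r1 s1_20 _ _ _] := best0.
  apply: (@den_For_inv (fun x => best_so_far k x s) _ _ _ _ (cap v).+1).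
  - by rewrite eval_bin (eval_cap_v r1 s1_20) /=; lia.
  - by have [? ? ? ? ?] := best0; split=> //; apply: ready_update.
  move=> x s' lt_x best; apply: try_candidate_best => //.
  by have [? ? ? ? ?] := best; split=> //; apply: ready_update.
move: (den (PFor _ _ _) s1) best1 => s2 [r2 s2_20 s2_21 mix2 [col2 [c [s17 ck cv s18]]
  low2]].
have in2 : has_input I s2 by case: r2.
rewrite (den_Set _ (eval_pos in2 (e1 := var 21) s2_21 (eval_u r2 s2_20)) erefl).
have best_c : cost_of k c = attach (@cap I) P Q F v u u k.
  rewrite /attach eqxx -s18; apply/eqP; rewrite eq_le.
  have [bk bv le_b] := best_splitP (@cap I) P Q F v u k.
  by rewrite low2 ?orbT //= s18 le_b.
split.
- exact: ready_update.
- move=> w k' le_k'; rewrite /update /= eqz_nat pos_inj s18 best_c.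
  case: (boolP ((k' == k) && (w == u))) => [/andP[/eqP-> /eqP->] | ne].
    by rewrite eqxx leqnn.
  rewrite mix2 //; case: (eqVneq w u) ne => //= _; rewrite andbT => ne_k.
  by rewrite [(k <= k')%N]leq_eqVlt [k == k']eq_sym (negbTE ne_k).
- by exists c; rewrite best_c.
- exact: col2.
Qed.

Definition holds_tables (G : V -> nat -> int) s : Prop :=
  forall w k, (k <= cap w)%N -> s 16%N (k * n + w)%N%:Z = G w k.

Lemma fill_step_holds s :
  ready s -> s 20%N 0 = t%:Z -> holds_tables F s ->
  [/\ ready (den fill_step s), holds_tables (attach (@cap I) P Q F v u) (den fill_step s),
      forall k, (k <= cap u)%N -> chosen k (den fill_step s)
    & forall w k, w != v -> den fill_step s 17%N (k * n + w)%N%:Z = s 17%N (k * n +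
      w)%N%:Z].
Proof.
move=> rs s20 tab.
have test : eval s (Bin Leq (Bin Add (var 20) (Cst 1)) (var 13)) = (true : nat)%:Z.
  by have [_ [s_cnt _ _ _] _ _] := rs;
    rewrite (eval_lt (e1 := var 20) (e2 := var 13) s20 s_cnt) lt_t.
rewrite /fill_step (den_If_bool _ _ test).
pose Inv m s' := [/\ ready s', s' 20%N 0 = t%:Z, holds_mixed F v u m s' &
  (forall k, (m <= k)%N -> (k <= cap u)%N -> chosen k s') /\
  forall w k, w != v -> s' 17%N (k * n + w)%N%:Z = s 17%N (k * n + w)%N%:Z].
suff [r' _ mix [ch other]] : Inv 0%N (den (PFor 21 (Bin Add (Get 1 e_u) (Cst 1))
  fill_entry) s).
  split=> // [w k le_k | k]; last exact: ch.
  by rewrite mix // andbT; case: eqP => [-> // | /eqP/negbTE w_u]; rewrite /attach w_u.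
apply: (@den_For_inv Inv _ _ _ _ (cap u).+1).
- by rewrite eval_bin (eval_cap_u rs s20) /=; lia.
- split=> //; first exact: ready_update.
    move=> w k le_k; rewrite -[update _ _ _ _ 16%N _]/(s 16%N _) tab //.
    case: eqP => //= eq_w; rewrite eq_w in le_k.
    by rewrite ltnNge le_k.
  by split=> // k lt_k le_k; rewrite ltnNge le_k in lt_k.
move=> k s' lt_k [r' s'20 mix [ch other]].
have r1 : ready (update s' 21 0 k%:Z) by apply: ready_update.
have [r2 mix2 ch2 other2] := fill_entry_holds (k := k) lt_k r1 s'20 erefl mix.
split=> //; first by rewrite den_frame.
split=> [k' | w k' w_v].
  rewrite leq_eqVlt => /predU1P[<- // | lt_k' le_k'].
  have [c [s17 ck cv best_c]] := ch k' lt_k' le_k'.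
  exists c; split=> //; rewrite other2 // eqz_nat pos_inj.
  by rewrite gtn_eqF.
by rewrite other2 ?eqz_nat ?pos_inj ?(negbTE w_v) ?andbF //; apply: other.
Qed.
End Step.

Lemma fill_step_skip t s :
  ready s -> s 20%N 0 = t%:Z -> (size st <= t)%N -> den fill_step s = s.
Proof.
move=> rs s20 le_t.
have test : eval s (Bin Leq (Bin Add (var 20) (Cst 1)) (var 13)) = (false : nat)%:Z.
  by have [_ [s_cnt _ _ _] _ _] := rs;
    rewrite (eval_lt (e1 := var 20) (e2 := var 13) s20 s_cnt) ltnNge le_t.
by rewrite /fill_step (den_If_bool _ _ test).
Qed.

Definition tables_from (t : nat) : V -> nat -> int := tables (@cap I) P Q (drop t st).

(** Each column of array 17 belongs to the new vertex of a single step, so that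
    treating another step does not overwrite it. *)
Definition all_chosen (m : nat) s : Prop :=
  forall t k, (m <= t)%N -> (t < size st)%N -> (k <= cap (nth (r, r) st t).2)%N ->
    chosen t (tables_from t.+1) k s.

Lemma steps_fst_uniq s : ready s -> uniq (map fst st).
Proof.
move=> [_ [_ _ _ [gr _]] _ _].
have [] := grows_uniq (isT : uniq [:: r]) gr.
by rewrite cat_uniq rev_uniq => /andP[].
Qed.

Lemma fill_holds s :
  ready s -> (size st <= n)%N -> (forall k, s 16%N k = 0) ->
  ready (den fill s) /\ all_chosen 0 (den fill s).
Proof.
move=> rs le_n zero.
pose Inv m s' := [/\ ready s', holds_tables (tables_from m) s' & all_chosen m s'].
suff [r' _ ch] : Inv 0%N (den fill s) by [].
apply: (@den_For_inv Inv _ _ _ _ n).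
- by case: rs => in_s _ _ _; rewrite [LHS](input_n in_s).
- split; first exact: ready_update.
    by move=> w k _; rewrite /tables_from drop_oversize // -[LHS]/(s 16%N _) zero.
  by move=> t k le_t lt_t; have := leq_trans lt_t (leq_trans le_n le_t); rewrite ltnn.
move=> t s' lt_n [r' tab ch].
have r1 : ready (update s' 20 0 t%:Z) by apply: ready_update.
have [le_t | lt_t] := leqP (size st) t.
  rewrite (fill_step_skip r1 (erefl _) le_t); split=> //.
    by move=> w k le_k; rewrite -[LHS]/(s' 16%N _) tab // /tables_from !drop_oversize ?leqW.
  by move=> t' k le_t' lt_t'; have := leq_trans lt_t' (leq_trans le_t le_t'); rewrite ltnn.
have [r2 tab2 ch2 other2] := fill_step_holds lt_t r1 (erefl _) tab.
split=> //.
  rewrite /tables_from (drop_nth (r, r)) //=.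
  by case: (nth _ _ _) tab2.
move=> t' k; rewrite leq_eqVlt => /predU1P[<- _ | lt_t' lt_s le_k]; first exact: ch2.
have [c [s17 ck cv best_c]] := ch t' k lt_t' lt_s le_k.
exists c; split=> //; rewrite other2 //.
have := nth_uniq r _ _ (steps_fst_uniq r'); rewrite size_map => uq.
have := uq t' t lt_s lt_t; rewrite !(nth_map (r, r)) // => ->.
by rewrite gtn_eqF.
Qed.
End Tables.

(** * Reading off a solution *)

(** Loops count down, whereas the steps are traced from the first to the last.
    Array 19 holds the capacity in use at each vertex, and array 18 the flow
    (position 0) and the value of y (position 1) of the current edge. *)
Definition e_t : expr := Bin Defs.Sub (Bin Defs.Sub e_n (Cst 1)) (var 20).
Definition e_child : expr := Get 12 e_t.
Definition e_parent : expr := Get 11 e_t.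

Definition write_pair (a : nat) (e : expr) : prog :=
  PSeq (PSet a (pos e_child e_parent) e) (PSet a (pos e_parent e_child) e).

(** For integers, y = 1 if x > 0 or Q < 0 is the single comparison
    1 <= x + (Q <= -1). *)
Definition read_choice : prog :=
  PSeq (PSet 18 (Cst 0)
         (cell 17 (Bin Defs.Sub (Get 1 e_parent) (Get 19 e_parent)) e_child))
       (PSet 18 (Cst 1)
         (Bin Leq (Cst 1)
           (Bin Add (tmp 0) (Bin Leq (cell 15 e_child e_parent) (Cst (-1)))))).

Definition use_capacity : prog :=
  PSeq (PSet 19 e_parent (Bin Add (Get 19 e_parent) (tmp 0)))
       (PSet 19 e_child (Bin Add (Get 19 e_child) (tmp 0))).

Definition trace_step : prog :=
  PIf (Bin Leq (Bin Add e_t (Cst 1)) (var 13))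
    (PSeq (PSeq read_choice use_capacity)
      (PSeq (write_pair 7 (tmp 0)) (PSeq (write_pair 8 (Cst 1)) (write_pair 9 (tmp 1)))))
    PSkip.

Definition trace : prog := PFor 20 e_n trace_step.

Section Trace.
Variables (I : instance) (r : 'I_(nvert I)).
Let n := nvert I.
Let V := 'I_(nvert I).
Variables (st : seq (V * V)) (P Q : V -> V -> int).
Hypothesis treeI : tree_instance I.
Implicit Types (w v u : V) (s : state).

Definition uses_edge v u (x : nat) : bool := (0 < x)%N || (Q v u < 0).

Definition written s v u (x : nat) : Prop :=
  forall k, k = (v * n + u)%N \/ k = (u * n + v)%N ->
  [/\ s 7%N k%:Z = x%:Z, s 8%N k%:Z = 1 & s 9%N k%:Z = (uses_edge v u x : nat)%:Z].

Section Step.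
Variables (t i : nat) (s : state).
Hypotheses (lt_t : (t < size st)%N) (t_i : (t + i).+1 = n) (rs : ready r st P Q s)
  (s20 : s 20%N 0 = i%:Z).
Let v := (nth (r, r) st t).1.
Let u := (nth (r, r) st t).2.

(** No assignment of a trace step changes which step is being traced. *)
Definition keeps s' : Prop := forall a k, needed a || (a == 20%N) -> s' a k = s a k.

Lemma keeps_ready s' : keeps s' -> ready r st P Q s'.
Proof. by move=> keep; apply: ready_ext rs => a k na; rewrite keep // na. Qed.

Lemma keeps_eval s' : keeps s' ->
  [/\ has_input I s', eval s' e_t = t%:Z, eval s' e_child = (v : nat)%:Z
    & eval s' e_parent = (u : nat)%:Z].
Proof.
move=> keep; have [in_s' [_ s_v s_u _] _ _] := keeps_ready keep.
have e_tE : eval s' e_t = t%:Z.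
  rewrite !eval_bin (eval_n in_s') /= keep // s20 -/n -t_i /=; lia.
split=> //.
  by rewrite -[LHS]/(s' 12%N (eval s' e_t)) e_tE s_v.
by rewrite -[LHS]/(s' 11%N (eval s' e_t)) e_tE s_u.
Qed.

Lemma keeps_update s' a k z : ~~ needed a -> a != 20%N -> keeps s' -> keeps (update s'
  a k z).
Proof.
move=> na a20 keep b l nb; rewrite /update; case: eqP => [eq_b | _] /=; last exact: keep.
by move: nb; rewrite eq_b (negbTE na) (negbTE a20).
Qed.

Lemma step_uv : v != u.
Proof. exact: (step_neq treeI lt_t rs). Qed.

Lemma read_choiceE (used c : nat) :
  s 19%N (u : nat)%:Z = used%:Z -> (used <= cap u)%N ->
  s 17%N ((cap u - used) * n + v)%N%:Z = c%:Z ->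
  den read_choice s = update (update s 18 0 c%:Z) 18 1 (uses_edge v u c : nat)%:Z.
Proof.
move=> s19 le_used s17.
have keep0 : keeps s by [].
have [in0 _ v0 u0] := keeps_eval keep0.
have rest : eval s (Bin Defs.Sub (Get 1 e_parent) (Get 19 e_parent)) = (cap u - used)%N%:Z.
  rewrite eval_bin -[eval s (Get 1 _)]/(s 1%N (eval s e_parent)).
  rewrite -[eval s (Get 19 _)]/(s 19%N (eval s e_parent)) u0 s19 (input_cap in0) /=.
  by rewrite -subzn.
have x0 : eval s (cell 17 (Bin Defs.Sub (Get 1 e_parent) (Get 19 e_parent)) e_child) = c%:Z.
  by rewrite (eval_cell in0 _ rest v0).
rewrite /read_choice den_Seq (den_Set _ (erefl _) x0).
have keep1 : keeps (update s 18 0 c%:Z) by apply: keeps_update.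
have [in1 _ v1 u1] := keeps_eval keep1.
apply: den_Set => //.
rewrite !eval_bin (eval_cell in1 _ v1 u1).
have [_ _ _ ->] := keeps_ready keep1.
rewrite /= /update /= /uses_edge; congr ((nat_of_bool _)%:Z).
by case: ltP; case: c {s17 x0 keep1 in1 v1 u1} => [|c] /=; lia.
Qed.

Lemma use_capacityE s' (x : int) :
  keeps s' -> s' 18%N 0 = x ->
  den use_capacity s' =
  update (update s' 19 (u : nat)%:Z (s' 19%N (u : nat)%:Z + x))
    19 (v : nat)%:Z (s' 19%N (v : nat)%:Z + x).
Proof.
move=> keep s18; have [_ _ _ uE] := keeps_eval keep.
have add_u : eval s' (Bin Add (Get 19 e_parent) (tmp 0)) = s' 19%N (u : nat)%:Z + x.
  by rewrite eval_bin -[eval s' (Get 19 _)]/(s' 19%N (eval s' e_parent)) uE -s18.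
rewrite /use_capacity den_Seq (den_Set _ uE add_u).
set s1 := update s' _ _ _; have keep1 : keeps s1 by rewrite /s1; apply: keeps_update.
have [_ _ vE _] := keeps_eval keep1.
rewrite (den_Set _ vE erefl) eval_bin -[eval s1 (Get 19 _)]/(s1 19%N (eval s1 e_child)) vE.
have s1v : s1 19%N (v : nat)%:Z = s' 19%N (v : nat)%:Z.
  by rewrite /s1 /update /= eqz_nat (inj_eq val_inj) (negbTE step_uv).
by rewrite s1v -s18.
Qed.

Lemma write_pairE s' a e (z : int) :
  keeps s' -> ~~ needed a -> a != 20%N -> eval s' e = z ->
  eval (update s' a (v * n + u)%N%:Z z) e = z ->
  den (write_pair a e) s' = update (update s' a (v * n + u)%N%:Z z) a (u * n + v)%N%:Z z.
Proof.
move=> keep na a20 ez ez'; have [in0 _ v0 u0] := keeps_eval keep.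
rewrite /write_pair den_Seq (den_Set _ (eval_pos in0 v0 u0) ez).
have keep1 : keeps (update s' a (v * n + u)%N%:Z z) by apply: keeps_update.
have [in1 _ v1 u1] := keeps_eval keep1.
by rewrite (den_Set _ (eval_pos in1 u1 v1) ez').
Qed.

Lemma trace_step_effect (used c : nat) :
  s 19%N (u : nat)%:Z = used%:Z -> (used <= cap u)%N ->
  s 17%N ((cap u - used) * n + v)%N%:Z = c%:Z ->
  let s' := den trace_step s in
  [/\ ready r st P Q s', written s' v u c,
      forall w, s' 19%N (w : nat)%:Z =
        s 19%N (w : nat)%:Z + (if (w == u) || (w == v) then c%:Z else 0)
    & forall a k, k != (v * n + u)%N%:Z -> k != (u * n + v)%N%:Z ->
        (6 < a < 10)%N -> s' a k = s a k].
Proof.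
move=> s19 le_used s17 s'.
have keep0 : keeps s by [].
have [_ tE _ _] := keeps_eval keep0.
have test : eval s (Bin Leq (Bin Add e_t (Cst 1)) (var 13)) = (true : nat)%:Z.
  by have [_ [s_cnt _ _ _] _ _] := rs; rewrite (eval_lt (e2 := var 13) tE s_cnt) lt_t.
have def_s' : s' =
    let s1 := update (update s 18 0 c%:Z) 18 1 (uses_edge v u c : nat)%:Z in
    let s2 := update (update s1 19 (u : nat)%:Z (s 19%N (u : nat)%:Z + c%:Z))
      19 (v : nat)%:Z (s 19%N (v : nat)%:Z + c%:Z) in
    let set_pair s a z := update (update s a (v * n + u)%N%:Z z) a (u * n + v)%N%:Z z in
    set_pair (set_pair (set_pair s2 7%N c%:Z) 8%N 1) 9%N (uses_edge v u c : nat)%:Z.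
  rewrite /s' /trace_step (den_If_bool _ _ test) den_Seq.
  rewrite [den (PSeq read_choice _) _]den_Seq (read_choiceE s19 le_used s17).
  have keep1 : keeps (update (update s 18 0 c%:Z) 18 1 (uses_edge v u c : nat)%:Z).
    by do 2!(apply: keeps_update => //).
  rewrite (use_capacityE keep1 (erefl _)).
  set s2 := update _ 19 _ _; have keep2 : keeps s2 by do 2!(apply: keeps_update => //).
  rewrite den_Seq (@write_pairE s2 7 (tmp 0) c%:Z) // den_Seq.
  have keep3 : keeps (update (update s2 7 (v * n + u)%N%:Z c%:Z) 7 (u * n + v)%N%:Z c%:Z).
    by do 2!(apply: keeps_update => //).
  rewrite (write_pairE (a := 8) (z := 1) keep3) //.
  by rewrite (write_pairE (z := (uses_edge v u c : nat)%:Z)) //;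
    do 2!(apply: keeps_update => //).
split.
- by apply: keeps_ready; rewrite def_s'; do 10!(apply: keeps_update => //).
- move=> k k_vu.
  have hit : (k%:Z == (u * n + v)%N%:Z) || (k%:Z == (v * n + u)%N%:Z).
    by rewrite !eqz_nat; case: k_vu => ->; rewrite eqxx ?orbT.
  by rewrite def_s' /update /=; case: (_ == _) hit => //= ->.
- move=> w; rewrite def_s' /update /= !eqz_nat !(inj_eq val_inj).
  have [-> | wv] := eqVneq w v; first by rewrite orbT.
  by case: eqP => [-> // | _]; rewrite addr0.
move=> a k /negbTE k1 /negbTE k2 a_out; rewrite def_s' /update /= k1 k2 !andbF.
have [-> ->] : (a == 19%N) = false /\ (a == 18%N) = false by split; apply/eqP; lia.
by [].
Qed.
End Step.

Lemma trace_step_skip t i s :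
  (t + i).+1 = n -> ready r st P Q s -> s 20%N 0 = i%:Z -> (size st <= t)%N ->
  den trace_step s = s.
Proof.
move=> t_i [in_s [s_cnt _ _ _] _ _] s20 le_t.
have tE : eval s e_t = t%:Z.
  by rewrite !eval_bin (eval_n in_s) /= s20 -/n -t_i /=; lia.
have test : eval s (Bin Leq (Bin Add e_t (Cst 1)) (var 13)) = (false : nat)%:Z.
  by rewrite (eval_lt (e2 := var 13) tE s_cnt) ltnNge le_t.
by rewrite /trace_step (den_If_bool _ _ test).
Qed.

(** The costs of the traced edges and the potential of the others add up to the
    table entry at the root. *)
Definition traced (t : nat) s : Prop :=
  exists xs : V * V -> nat,
  [/\ {in take t st, forall p, written s p.1 p.2 (xs p)},
      forall w, s 19%N (w : nat)%:Z = (\sum_(p <- take t st | incident w p) xs p)%N%:Z,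
      forall w, (\sum_(p <- take t st | incident w p) xs p <= cap w)%N
    & \sum_(p <- take t st) edge_cost P Q p.1 p.2 (xs p) +
        \sum_(w <- found r (take t st)) tables_from st P Q t w
          (cap w - \sum_(p <- take t st | incident w p) xs p)%N =
      tables (@cap I) P Q st r (cap r)].

Lemma trace_step_traced t i s :
  (t < size st)%N -> (t + i).+1 = n -> ready r st P Q s -> s 20%N 0 = i%:Z ->
  all_chosen r st P Q 0 s -> traced t s ->
  ready r st P Q (den trace_step s) /\ traced t.+1 (den trace_step s).
Proof.
move=> lt_t t_i rs s20 ch [xs [out s19 le_cap pot]].
case def_p : (nth (r, r) st t) => [v u].
have [_ [_ _ _ [gr e_st]] _ _] := rs.
pose used w := (\sum_(p <- take t st | incident w p) xs p)%N.
have [c [s17 ck cv best_c]] : chosen r st P Q t (tables_from st P Q t.+1) (cap u - used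
  u) s.
  by apply: ch; rewrite // def_p leq_subr.
rewrite def_p /= in s17 cv best_c.
have := trace_step_effect lt_t t_i rs s20 (used := used u) (c := c).
rewrite def_p /= => /(_ (s19 u) (le_cap u) s17) [r' out' s19' other].
split=> //.
have take_t1 : take t.+1 st = rcons (take t st) (v, u) by rewrite (take_nth (r, r)) //
  def_p.
have gr_take : grows [:: r] (take t.+1 st).
  by apply: (@grows_cat _ _ _ (drop t.+1 st)); rewrite cat_take_drop.
have := gr_take; rewrite take_t1 grows_rcons => /and3P[gr_t Su nSv].
have fresh p : p \in take t st -> incident v p = false.
  move=> /(grows_mem gr_t) /andP[p1 p2]; apply/negP => /orP[] /eqP eq_v.
    by rewrite -eq_v p1 in nSv.
  by rewrite -eq_v p2 in nSv.
pose xs' p := if p == (v, u) then c else xs p.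
have xs'E p : p \in take t st -> xs' p = xs p.
  move=> /fresh; rewrite /xs'; case: eqP => // ->.
  by rewrite /incident eqxx.
have used_v : used v = 0%N.
  by rewrite /used big_seq_cond big_pred0 // => p; case: (boolP (p \in _)) => //= /fresh.
pose used' w := (\sum_(p <- take t.+1 st | incident w p) xs' p)%N.
have used'E w : used' w = (used w + (if (w == u) || (w == v) then c else 0))%N.
  rewrite /used' take_t1 -cats1 big_cat /= big_cons big_nil; congr (_ + _)%N.
    by rewrite big_seq_cond [RHS]big_seq_cond; apply: eq_bigr => p /andP[/xs'E].
  by rewrite /incident /= /xs' eqxx addn0 orbC ![_ == w]eq_sym.
exists xs'; split.
- move=> p; rewrite take_t1 mem_rcons inE => /predU1P[-> | p_t]; first by rewrite /xs' eqxx.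
  rewrite xs'E // => k k_p; have p_st := mem_take p_t.
  have [o7 o8 o9] := out p p_t k k_p.
  have vu_st : (v, u) \in st by rewrite -def_p mem_nth.
  have p_vu : p != (v, u) by apply: contraFneq (fresh p p_t) => ->; rewrite /incident eqxx.
  have p_uv : (p.2, p.1) != (v, u).
    apply: contraFneq (fresh p p_t) => -[<- _].
    by rewrite /incident eqxx orbT.
  case: p {p_t} p_vu p_uv k_p o7 o8 o9 {p_st} => a b /= p_vu p_uv k_p o7 o8 o9.
  move: p_vu p_uv; rewrite !xpair_eqE => p_vu p_uv.
  have [k1 k2] : k%:Z != (v * n + u)%N%:Z /\ k%:Z != (u * n + v)%N%:Z.
    by rewrite !eqz_nat; case: k_p => ->; rewrite !pos_inj //; split; rewrite // andbC.
  by rewrite !other.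
- move=> w; rewrite s19' s19  -[in RHS]/(used' w) used'E -/(used w); case: ifP => _;
  last by rewrite addr0 addn0.
  by rewrite PoszD.
- move=> w; rewrite -[X in (X <= _)%N]/(used' w) used'E.
  case: ifP => [|_]; last by rewrite addn0; apply: le_cap.
  case/orP => /eqP->; last by rewrite used_v.
  by rewrite -leq_subRL //; apply: le_cap.
have uA : uniq (found r (take t st)).
  by have [] := grows_uniq (isT : uniq [:: r]) gr_t.
have k'E w : (cap w - used' w)%N =
    if (w == u) || (w == v) then (cap w - used w - c)%N else (cap w - used w)%N.
  by rewrite used'E; case: ifP => _; rewrite ?addn0 ?subnDA.
have kv : (cap v - used v)%N = cap v by rewrite used_v subn0.
have best_c' : split_cost (@cap I) P Q (tables_from st P Q t.+1) v u (cap u - used u) c =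
    tables (@cap I) P Q ((v, u) :: drop t.+1 st) u (cap u - used u).
  by rewrite -[RHS]best_c /cost_of def_p.
have step := tables_backtrack (k := fun w => (cap w - used w)%N) uA Su nSv kv best_c' k'E.
rewrite -pot /tables_from (drop_nth (r, r) lt_t) def_p -/used step.
have -> : \sum_(p <- take t.+1 st) edge_cost P Q p.1 p.2 (xs' p) =
    \sum_(p <- take t st) edge_cost P Q p.1 p.2 (xs p) + edge_cost P Q v u c.
  rewrite take_t1 -cats1 big_cat big_seq1 /= {2}/xs' eqxx.
  by congr (_ + _); apply: eq_big_seq => p /xs'E ->.
have -> : found r (take t.+1 st) = v :: found r (take t st).
  by rewrite /found take_t1 map_rcons rev_rcons.
by rewrite -addrA [edge_cost _ _ _ _ _ + _]addrC.
Qed.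

Lemma trace_traced s :
  ready r st P Q s -> all_chosen r st P Q 0 s -> (size st <= n)%N ->
  (forall k, s 19%N k = 0) -> traced (size st) (den trace s).
Proof.
move=> rs ch le_n zero.
pose Inv i s' := [/\ ready r st P Q s', all_chosen r st P Q 0 s' &
  traced (minn (n - i) (size st)) s'].
suff [_ _] : Inv 0%N (den trace s) by rewrite subn0 (minn_idPr le_n).
apply: (@den_For_inv Inv _ _ _ _ n).
- by case: rs => in_s _ _ _; rewrite (eval_n in_s).
- split; first exact: ready_update.
    exact: ch.
  rewrite subnn min0n; exists (fun _ => 0%N); rewrite take0.
  split=> [//|w|w|]; rewrite ?big_nil //; first exact: zero.
  by rewrite add0r /found /= big_seq1 /tables_from drop0 big_nil subn0.
move=> i s' lt_i [r' ch' tr].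
have r1 : ready r st P Q (update s' 20 0 i%:Z) by apply: ready_update.
have t_i : ((n - i.+1) + i).+1 = n by lia.
have min_t : (n - i = (n - i.+1).+1)%N by lia.
have [le_t | lt_t] := leqP (size st) (n - i.+1).
  rewrite (trace_step_skip t_i r1 (erefl _) le_t); split=> //.
  by move: tr; rewrite (minn_idPr le_t) (minn_idPr _) // min_t leqW.
move: tr; rewrite (minn_idPl (ltnW lt_t)) => tr.
have [r2 tr2] := trace_step_traced lt_t t_i r1 (erefl _) ch' tr.
split=> //; last by rewrite min_t (minn_idPl _).
move=> t k le_t lt_st le_k; have [c [s17 ck cv best_c]] := ch' t k le_t lt_st le_k.
by exists c; split=> //; rewrite den_frame.
Qed.

End Trace.

(** * The algorithm *)

Definition program : prog := PSeq discover (PSeq scale (PSeq fill trace)).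

Lemma program_solves (R : realType) (I : instance) (s := den program (input_state I)) :
  tree_instance I ->
  exists x y, returns s x y /\
    optimal (fun i j : 'I_(nvert I) => ratr (x i j) : R) y.
Proof.
move=> treeI; have [tree p_sym q_sym] := treeI.
have [n_gt0 e_sym _ _ _] := tree; pose r := Ordinal n_gt0.
pose s1 := den discover (input_state I); pose s2 := den scale s1.
pose s3 := den fill s2.
have [st [in1 st1 all_st lt_st]] : exists st, [/\ has_input I s1, holds_steps r st s1,
    forall i, i \in found r st & (size st < nvert I)%N].
  exact: discover_search.
have [in2 scaled2] := scale_scaled in1.
pose P i j := s2 14%N (i * nvert I + j)%N%:Z.
pose Q i j := s2 15%N (i * nvert I + j)%N%:Z.
have ready2 : ready r st P Q s2.
  have [s_cnt s_v s_u st_ok] := st1.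
  by split=> //; split=> [|t lt_t|t lt_t|//]; rewrite /s2 den_frame // ?s_v ?s_u.
have zero2 k : s2 16%N k = 0 by rewrite /s2 den_frame // /s1 den_frame.
have [ready3 chosen3] := fill_holds treeI ready2 (ltnW lt_st) zero2.
have zero3 k : s3 19%N k = 0.
  by rewrite /s3 den_frame // /s2 den_frame // /s1 den_frame.
have [xs] := trace_traced treeI ready3 chosen3 (ltnW lt_st) zero3.
rewrite -[den trace _]/s take_size => -[out used_xs le_cap pot].
have [_ _ _ [gr e_st]] := st1.
pose x i j := if (i, j) \in st then xs (i, j) else xs (j, i).
pose y i j := if (i, j) \in st then uses_edge Q i j (x i j) else uses_edge Q j i (x i j).
have edge_cases i j : edge i j ->
    ((i, j) \in st /\ (j, i) \notin st) \/ ((j, i) \in st /\ (i, j) \notin st).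
  rewrite (tree_edge_mem tree gr e_st all_st) => /orP[] ij; [left | right];
    by split=> //; apply: grows_asym gr ij.
have x_sym : edge_symmetric (@edge I) x.
  by move=> i j /edge_cases[] [ij ji]; rewrite /x ij (negbTE ji).
have y_sym : edge_symmetric (@edge I) y.
  by move=> i j /edge_cases[] [ij ji]; rewrite /y /x ij (negbTE ji).
exists (fun i j => (x i j)%:R), y; split.
  move=> i j e_ij k.
  have [s7 s8 s9] : [/\ s 7%N k = (x i j)%:Z, s 8%N k = 1 & s 9%N k = (y i j : nat)%:Z].
    rewrite /x /y; case: (edge_cases i j e_ij) => [] [ij ji].
      by rewrite ij /x ij; apply: (out _ ij); left.
    by rewrite (negbTE ji) /x (negbTE ji); apply: (out _ ij); right.
  rewrite s7 s8 s9; split=> //.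
    by rewrite -[(x i j)%:R]/((x i j)%:Z%:~R) numq_int.
  by rewrite -[(x i j)%:R]/((x i j)%:Z%:~R) denq_int.
have x_st : {in st, forall p, x p.1 p.2 = xs p} by case=> a b ab; rewrite /x ab.
apply: (@optimal_of_tables R I r st (common_den I) P Q) => //.
- exact: common_den_gt0.
- by move=> i j /scaled2[].
- by move=> i j /scaled2[].
- by case=> a b ab; rewrite /y /= ab.
- move=> w; apply: leq_trans (le_cap w); rewrite big_seq_cond [in leqRHS]big_seq_cond.
  by apply/eq_leq/eq_bigr => p /andP[/x_st ->].
rewrite -pot [X in _ = _ + X]big1 ?addr0 => [|w _]; last by rewrite /tables_from drop_size.
by apply: eq_big_seq => p /x_st ->.
Qed.

Theorem mainTheorem3 (R : realType) :
  exists (prog : cmd) (c k : nat),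
  forall I : instance, tree_instance I ->
  exists (t : nat) (s : state)
         (x : 'I_(nvert I) -> 'I_(nvert I) -> rat)
         (y : 'I_(nvert I) -> 'I_(nvert I) -> bool),
    [/\ exec prog (input_state I) t s,
        (t <= c * (nvert I + max_cap I + cost_length I) ^ k)%N,
        returns s x y
      & optimal (fun i j => ratr (x i j) : R) y].
Proof.
have [c [k time]] := tame_polynomial_time (isT : tame program).
exists (compile program), c, k => I treeI.
have [t run le_t] := time I treeI.
have [x [y [ret opt]]] := program_solves R treeI.
by exists t, (den program (input_state I)), x, y.
Qed.
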